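(* Let $m=x_1^{d_1}\cdots x_n^{d_n}$ be any minimal monomial generator of $I=(x_1,\dots,x_n)^d$ (so $d_1+\dots+d_n=d$), and let $\mathrm{supp}(m)=\{u: d_u\neq 0\}$. For each $i\in\{1,\dots,n\}$ let $X_i$ be the complex of boxes of the principal $Q_i$-Borel ideal $I_i=\mathrm{Borel}_{Q_i}(m)$. Then the complex $$X=\bigcup_{u\in \mathrm{supp}(m)} X_{u+1}$$ (indices modulo $n$) supports a minimal free resolution of $I$.
   Context: $k$ is a field, $S=k[x_1,\dots,x_n]$, $d\ge 1$. $G(B)$ denotes the minimal monomial generating set of a monomial ideal $B$. Indices of variables are read modulo $n$. Cyclic intervals: $[i,j]=\{i,i+1,\dots,j\}$ if $i\le j$, and $[i,j]=\{i,\dots,n,1,\dots,j\}$ if $i>j$ (so $[i,i-1]=\{1,\dots,n\}$). $Q_i$ is the total order $x_i<x_{i+1}<\dots<x_n<x_1<\dots<x_{i-1}$. A monomial ideal $B$ is $Q_i$-Borel if for every monomial $f\in B$, every $x_b$ dividing $f$ and every $x_a<_{Q_i}x_b$ one has $f x_a/x_b\in B$. $\mathrm{Borel}_{Q_i}(m)$ is the smallest $Q_i$-Borel ideal containing $m$. For a monomial $f=x_{j_1}\cdots x_{j_d}$ with $x_{j_1}\le_{Q_i}\dots\le_{Q_i}x_{j_d}$, the box $\Gamma_i(f)$ is the polytope $\Delta_{[i,j_1]}\times\Delta_{[j_1,j_2]}\times\dots\times\Delta_{[j_{d-1},j_d]}$, where $\Delta_{[a,b]}$ is the simplex with vertex set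 $\{x_c:c\in[a,b]\}$. A vertex of the box is a tuple of variables and is labelled by the product of these variables (distinct vertices have distinct labels); the box is realized in $\mathbb{R}^n$ as the convex hull of the exponent vectors of its vertex labels. If $B$ is a $Q_i$-Borel ideal generated in degree $d$, its complex of boxes is the polytopal complex consisting of all faces of the boxes $\Gamma_i(f)$, $f\in G(B)$. A polytopal complex $X$ with vertices labelled by monomials is a labelled complex, with $\ell(F)=\mathrm{lcm}\{\ell(v):v\in F\text{ a vertex}\}$ for each face $F$. It yields a complex of free $S$-modules with one basis element in homological degree $\dim F$ and multidegree $\ell(F)$ for each nonempty face $F$, and differential $\partial(F)=\sum_{G}\mathrm{sign}(G,F)\frac{\ell(F)}{\ell(G)}G$ over facets $G$ of $F$ (with the usual incidence signs). $X$ supports a (minimal) free resolution of a monomial ideal $M$ if its vertex labels generate $M$ and this complex is a (minimal) free resolution of $M$ (equivalently, of $S/M$ after adding the empty face). *)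

(* Defs.v *)
From mathcomp Require Import all_boot all_order all_algebra.
From mathcomp Require Import mpoly.

Set Implicit Arguments.
Unset Strict Implicit.
Unset Printing Implicit Defensive.

Import GRing.Theory Num.Theory.
Local Open Scope ring_scope.

(* The variables x_1, ..., x_n are indexed from 0, by 'I_n. *)

Section Ideals.
Variables (n : nat) (k : fieldType).
Local Notation S := {mpoly k[n]}.

Definition ideal_gen (G : S -> Prop) (p : S) : Prop :=
  exists2 s : seq (S * S),
    forall x, x \in s -> G x.2 & p = \sum_(x <- s) x.1 * x.2.

Definition ideal_exp (J : S -> Prop) (d : nat) : S -> Prop :=
  ideal_gen (fun p => exists2 t : d.-tuple S,
    forall i, J (tnth t i) & p = \prod_(i < d) tnth t i).

Definition vars_ideal : S -> Prop :=
  ideal_gen (fun p => exists i : 'I_n, p = 'X_i).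

Definition monomials_ideal (U : 'X_{1..n} -> Prop) : S -> Prop :=
  ideal_gen (fun p => exists2 u, U u & p = 'X_[u]).

Definition monomial_ideal (B : S -> Prop) : Prop :=
  exists U : 'X_{1..n} -> Prop, forall p, B p <-> monomials_ideal U p.

(* The minimal monomial generating set G(B); (v <= u)%MM is divisibility. *)
Definition min_gen (B : S -> Prop) (u : 'X_{1..n}) : Prop :=
  B 'X_[u] /\ forall v : 'X_{1..n}, B 'X_[v] -> (v <= u)%MM -> v = u.

End Ideals.

Section CyclicOrders.
Variable n : nat.

(* x_a has rank 0 in Q_i when a = i, rank 1 when a = i + 1 mod n, etc. *)
Definition Qrank (i a : 'I_n) : nat := ((a + (n - i)) %% n)%N.
Definition Qlt (i : 'I_n) : rel 'I_n := fun a b => (Qrank i a < Qrank i b)%N.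
Definition Qle (i : 'I_n) : rel 'I_n := fun a b => (Qrank i a <= Qrank i b)%N.

Definition cyc_interval (a b : 'I_n) : {set 'I_n} :=
  [set c : 'I_n | if (a <= b)%N then (a <= c <= b)%N
                  else (a <= c)%N || (c <= b)%N].

Definition Qborel (k : fieldType) (i : 'I_n) (B : {mpoly k[n]} -> Prop) : Prop :=
  monomial_ideal B /\
  forall (f : 'X_{1..n}) (a b : 'I_n), B 'X_[f] -> (0 < f b)%N -> Qlt i a b ->
    B 'X_[(f - U_(b) + U_(a))%MM].

Definition principal_Qborel (k : fieldType) (i : 'I_n) (m : 'X_{1..n})
    (p : {mpoly k[n]}) : Prop :=
  forall B : {mpoly k[n]} -> Prop, Qborel i B -> B 'X_[m] -> B p.

End CyclicOrders.

(* A polytope with vertices in N^n is given by its vertex set, a finite set of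
   exponent vectors, identified with the monomial labels of the vertices; the
   bound D on degrees makes the type of all such sets finite.  R plays the role
   of the real numbers. *)
Section Polytopes.
Variables (R : realFieldType) (n D : nat).
Local Notation vset := {set 'X_{1..n < D}}.

Definition point (v : 'X_{1..n}) : 'rV[R]_n := \row_j (v j)%:R.

Definition in_hull (V : vset) (x : 'rV[R]_n) : Prop :=
  exists w : 'X_{1..n < D} -> R,
    [/\ forall v, v \in V -> 0 <= w v, \sum_(v in V) w v = 1
      & x = \sum_(v in V) w v *: point v].

(* The empty face is included. *)
Definition face_of (V W : vset) : Prop :=
  exists (a : 'I_n -> R) (c : R),
    (forall v, v \in V -> \sum_j a j * (v j)%:R <= c) /\
    W = [set v in V | \sum_j a j * (v j)%:R == c].

(* Dimension of the affine hull (0 for the empty set). *)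
Definition pdim (V : vset) : nat :=
  \rank (\sum_(v in V) \sum_(w in V) <<point v - point w>>)%MS.

Definition facet_of (V W : vset) : Prop :=
  [/\ face_of V W, W <> set0 & pdim V = (pdim W).+1].

Definition polytopal_complex (X : vset -> Prop) : Prop :=
  [/\ X set0,
      forall F v, X F -> v \in F -> face_of F [set v],
      forall F G, X F -> face_of F G -> X G
    & forall F G, X F -> X G -> exists H,
        [/\ face_of F H, face_of G H
          & forall x, in_hull F x /\ in_hull G x <-> in_hull H x]].

(* Incidence signs are only unique up to changing the orientation of cells. *)
Definition incidence (X : vset -> Prop) (eps : vset -> vset -> int) : Prop :=
  [/\ forall F G, X F -> facet_of F G -> eps F G = 1 \/ eps F G = -1,
      forall F G, X F -> ~ facet_of F G -> eps F G = 0,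
      forall F, X F -> pdim F = 1%N -> \sum_G eps F G = 0
    & forall F H, X F -> \sum_G eps F G * eps G H = 0].

End Polytopes.

Section CellularResolutions.
Variables (R : realFieldType) (k : fieldType) (n D : nat).
Local Notation S := {mpoly k[n]}.
Local Notation vset := {set 'X_{1..n < D}}.

Definition label (F : vset) : 'X_{1..n} :=
  \big[@mlcm n/0%MM]_(v in F) (v : 'X_{1..n}).

(* The free module in homological degree i, as functions supported on the
   nonempty i-dimensional cells. *)
Definition chain (X : vset -> Prop) (i : nat) (c : {ffun vset -> S}) : Prop :=
  forall F, c F <> 0 -> [/\ X F, F <> set0 & pdim R F = i].

Definition boundary (eps : vset -> vset -> int) (c : {ffun vset -> S}) :
    {ffun vset -> S} :=
  [ffun G => \sum_F (eps F G)%:~R * 'X_[(label F - label G)%MM] * c F].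

Definition augmentation (c : {ffun vset -> S}) : S :=
  \sum_F 'X_[label F] * c F.

Definition free_resolution (X : vset -> Prop) (eps : vset -> vset -> int)
    (M : S -> Prop) : Prop :=
  [/\ forall p, M p <-> exists2 c, chain X 0 c & augmentation c = p,
      forall c, chain X 0 c ->
        (augmentation c = 0 <-> exists2 b, chain X 1 b & boundary eps b = c)
    & forall i c, chain X i.+1 c ->
        (boundary eps c = 0 <->
         exists2 b, chain X i.+2 b & boundary eps b = c)].

Definition minimal_complex (X : vset -> Prop) (eps : vset -> vset -> int) :
    Prop :=
  forall i c, chain X i.+1 c -> forall G, vars_ideal (boundary eps c G).

Definition supports_minimal_free_resolution (X : vset -> Prop)
    (M : S -> Prop) : Prop :=
  [/\ polytopal_complex R X,
      forall p, M p <->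
        monomials_ideal (fun u => exists2 v, X [set v] & u = val v) p,
      exists eps, incidence R X eps
    & forall eps, incidence R X eps ->
        free_resolution X eps M /\ minimal_complex X eps].

End CellularResolutions.

Section Boxes.
Variables (R : realFieldType) (n : nat).

(* The indices j_1, ..., j_d with f = x_{j_1} ... x_{j_d}, sorted for Q_i. *)
Definition Qfactors (i : 'I_n) (f : 'X_{1..n}) : seq 'I_n :=
  sort (Qle i) (flatten [seq nseq (f a) a | a <- enum 'I_n]).

(* The intervals [i, j_1], [j_1, j_2], ..., [j_{d-1}, j_d]. *)
Definition box_intervals (i : 'I_n) (f : 'X_{1..n}) : seq {set 'I_n} :=
  pairmap (@cyc_interval n) i (Qfactors i f).

Definition box (d : nat) (i : 'I_n) (f : 'X_{1..n}) :
    {set 'X_{1..n < d.+1}} :=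
  [set v : 'X_{1..n < d.+1} | [exists c : d.-tuple 'I_n,
     all2 (fun (a : 'I_n) (J : {set 'I_n}) => a \in J) c (box_intervals i f)
     && ((\sum_(a <- c) U_(a))%MM == val v)]].

Definition complex_of_boxes (k : fieldType) (d : nat) (i : 'I_n)
    (B : {mpoly k[n]} -> Prop) (F : {set 'X_{1..n < d.+1}}) : Prop :=
  exists2 f, min_gen B f & face_of R (box d i f) F.

End Boxes.

(* Main.v *)
Require Import Defs.
From mathcomp Require Import all_boot all_order all_algebra.
From mathcomp Require Import mpoly zify ring.

Set Implicit Arguments.
Unset Strict Implicit.
Unset Printing Implicit Defensive.

Import Order.TTheory GRing.Theory Num.Theory.

(** Why the theorem holds.

    Write the monomial as the product of the x_(s p), p < d, with s weakly increasing. A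
    nonempty face of a box for Q_(u+1) is a product of simplices on sets A_1, ..., A_d of
    variables, weakly increasing for Q_(u+1). For two orders Q_(u+1) and Q_(u'+1) with u and
    u' in the support, the same face is described by two sequences that differ by a rotation;
    indexing the sets by the factors of the monomial instead of by their positions makes the
    description independent of the order. Replacing a variable in A_p by its representative
    modulo n in the interval from s p - n, excluded, to s p turns all the faces of X into
    periodic weakly increasing sequences of sets of integers ([separated]), and the faces of
    X_(u+1) are those contained in the [window] of u ([complex_good_cells]).

    A point of a cell is a sum of points of the simplices on the A_p. This decomposition is
    unique, also between cells of different orders ([good_unique]): comparing masses in the
    arc from u to u' shows that the point lies in both windows, and within one window the
    sets are weakly increasing for a linear order. So cells intersect along the cell of the
    intersected labels, the dimension of a cell is the number of its pairs (p, a) minus d,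
    and its facets are obtained by removing one pair ([facet_cell]). Thus X is a polytopal
    complex, with signs as in a simplex ([incidence_exists]). Any monomial of degree d is a
    vertex, by choosing the largest admissible cyclic shift of its factors
    ([good_choice_exists]).

    For exactness, the part of multidegree mu of the cellular complex is the augmented chain
    complex of the cells dividing mu. The good vertices dividing mu are stable under
    componentwise maximum ([good_choice_max]), so there is a top vertex g. Let the pivot of a
    cell be the last factor p with A_p different from the singleton of g p, for the order of
    the first window that contains the cell. Adding or removing g p at the pivot is a
    perfect matching of the cells, the empty one included, and it is acyclic ([mrank_lt]).
    Incidences along the matching are 1 or -1, so the complex is exact for any incidence
    function ([matching_acyclic], [scalar_acyclic]). The resolution is minimal because
    removing a pair (p, a) lowers the exponent of x_a in the label ([label_remove]). *)

(** * Labelled cells *)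

Section LabelledCells.
Variables (n d : nat) (s : 'I_d -> 'I_n).
Hypothesis s_mono : forall p q : 'I_d, p <= q -> s p <= s q.

(** Think of a cell as a family of subsets A_p of the cyclically ordered variables,
    one for each factor x_(s p) of the monomial. A variable [a] of A_p has a unique
    integer representative modulo n in the interval from [s p - n], excluded, to
    [s p]; [level] is that representative, increased by [n] so as to stay in [nat].
    Comparing levels replaces all the orders Q_i at once. *)
Definition level (x : 'I_d * 'I_n) : nat :=
  if x.2 <= s x.1 then x.2 + n else x.2.

(** Extended by the period (p + d, level + n), the levels of the sets A_p form a
    weakly increasing sequence of sets; this is that condition on one period, and it
    does not mention any of the orders Q_i. *)
Definition separated (A : {set 'I_d * 'I_n}) : bool :=
  [forall x in A, forall y in A,
    (x.1 < y.1) ==> (level x <= level y <= level x + n)].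

(** In component p, the cyclic interval from u, excluded, to [s p]: the variables that do
    not exceed [s p] in the order that starts after u. In terms of levels this is only
    a lower bound, so windows are stable under increasing levels. *)
Definition window (u : 'I_n) : {set 'I_d * 'I_n} :=
  [set x | if u < s x.1 then u + n < level x else u < level x].

Definition full (A : {set 'I_d * 'I_n}) : bool :=
  [forall p, exists a, (p, a) \in A].

(** The labelled form of the nonempty faces of the complex of boxes of
    the order that starts after [u]. *)
Definition good (u : 'I_n) (A : {set 'I_d * 'I_n}) : bool :=
  [&& full A, separated A & A \subset window u].

(** The variables ranked by the order that starts after [u] (the smallest one has
    rank [u + 1]), and the factors of the monomial ranked accordingly. *)
Definition vrank (u a : 'I_n) : nat := if a <= u then a + n else a.
Definition frank (u : 'I_n) (p : 'I_d) : nat := if s p <= u then p + d else p.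

Lemma fullP (A : {set 'I_d * 'I_n}) :
  reflect (forall p, exists a, (p, a) \in A) (full A).
Proof.
apply: (iffP forallP) => fA p; first by case/existsP: (fA p) => a; exists a.
by apply/existsP.
Qed.

Lemma separatedP (A : {set 'I_d * 'I_n}) :
  reflect (forall x y, x \in A -> y \in A -> x.1 < y.1 ->
             level x <= level y <= level x + n) (separated A).
Proof.
apply: (iffP forall_inP) => [sA x y xA yA|sA x xA].
  by have /forall_inP/(_ y yA)/implyP := sA x xA.
by apply/forall_inP => y yA; apply/implyP; exact: sA.
Qed.

Lemma vrank_inj u : injective (vrank u).
Proof.
move=> a b; rewrite /vrank => ab; apply/val_inj => /=.
by move: ab (ltn_ord a) (ltn_ord b); case: ifP; case: ifP; lia.
Qed.

Lemma frank_inj u : injective (frank u).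
Proof.
move=> p q; rewrite /frank => pq; apply/val_inj => /=.
by move: pq (ltn_ord p) (ltn_ord q); case: ifP; case: ifP; lia.
Qed.

Lemma frank_lt u p : frank u p < d + d.
Proof. by rewrite /frank; move: (ltn_ord p); case: ifP; lia. Qed.

Lemma level_vrank u x : x \in window u ->
  level x = if u < s x.1 then vrank u x.2 + n else vrank u x.2.
Proof.
case: x => p a; rewrite inE /level /vrank /=.
by move: (ltn_ord a) (ltn_ord u) (ltn_ord (s p)); do !case: ifP; lia.
Qed.

Lemma window_vrank u x : (x \in window u) = (vrank u x.2 <= vrank u (s x.1)).
Proof.
case: x => p a; rewrite inE /level /vrank /=.
by move: (ltn_ord a) (ltn_ord u) (ltn_ord (s p)); do !case: ifP; lia.
Qed.

Lemma vrank_gt (u a : 'I_n) : u < vrank u a <= u + n.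
Proof. by rewrite /vrank; move: (ltn_ord a) (ltn_ord u); case: ifP; lia. Qed.

(** Inside a window the cyclic condition is a linear one: the sets A_p, listed in the
    order of their factors starting after [u], are weakly increasing. *)
Lemma separated_vrank u (A : {set 'I_d * 'I_n}) : A \subset window u ->
  reflect (forall x y, x \in A -> y \in A -> frank u x.1 < frank u y.1 ->
             vrank u x.2 <= vrank u y.2) (separated A).
Proof.
move=> /subsetP Aw; apply: (iffP (separatedP A)) => sA [p a] [q b] xA yA /=.
  move: (sA _ _ xA yA) (sA _ _ yA xA) (@s_mono p q) (@s_mono q p).
  rewrite /frank (level_vrank (Aw _ xA)) (level_vrank (Aw _ yA)) /=.
  move: (ltn_ord p) (ltn_ord q) (vrank_gt u a) (vrank_gt u b).
  by do !case: ifP; lia.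
move=> xy; have := s_mono (ltnW xy).
move: (sA _ _ xA yA) (sA _ _ yA xA) (vrank_gt u a) (vrank_gt u b).
rewrite /frank (level_vrank (Aw _ xA)) (level_vrank (Aw _ yA)) /=.
move: (ltn_ord p) (ltn_ord q).
by do !case: ifP; lia.
Qed.

Lemma goodP u (A : {set 'I_d * 'I_n}) : reflect
  [/\ forall p, exists a, (p, a) \in A, A \subset window u &
      forall x y, x \in A -> y \in A -> frank u x.1 < frank u y.1 ->
             vrank u x.2 <= vrank u y.2] (good u A).
Proof.
apply: (iffP and3P) => [[fA sA wA]|[fA wA sA]].
  by split=> //; [exact/fullP | apply/separated_vrank].
by split=> //; [exact/fullP | apply/(separated_vrank wA)].
Qed.

Lemma good_sub u (A B : {set 'I_d * 'I_n}) : good u A -> B \subset A -> full B ->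
  good u B.
Proof.
move=> /goodP [_ wA sA] BA fB; apply/goodP; split; first exact/fullP.
  exact: subset_trans wA.
by move=> x y xB yB; apply: sA; exact: (subsetP BA).
Qed.

Lemma good_window u u' A : good u A -> A \subset window u' -> good u' A.
Proof. by move=> /and3P [fA sA _] wA; apply/and3P. Qed.

(** ** Uniqueness of decompositions *)

Section Uniqueness.
Variable R : realFieldType.
Local Open Scope ring_scope.
Implicit Types t y z : 'I_d -> 'I_n -> R.

Lemma signed_sum0 (I : finType) (f : I -> R) (i : I) :
  \sum_j f j = 0 -> 0 < f i -> exists2 j, j != i & f j < 0.
Proof.
move=> f0 fi; have [/existsP[j /andP [ji fj]]|] :=
  boolP [exists j, (j != i) && (f j < 0)]; first by exists j.
rewrite negb_exists => /forallP h.
suff: 0 < \sum_j f j by rewrite f0 ltxx.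
rewrite (bigD1 i) //=; apply: ltr_wpDr => //; apply: sumr_ge0 => j ji.
by move: (h j); rewrite ji /= -leNgt.
Qed.

(** A positive first entry [t p a] forces a negative entry [t p b] with b after a.
    Then the sets B_q of all later factors have no element before b, so that column
    [a] has no negative entry to compensate [t p a]. *)
Lemma sep_first u (A B : {set 'I_d * 'I_n}) t p a :
  good u A -> good u B ->
  (forall q b, t q b < 0 -> (q, b) \in B) ->
  (forall q, \sum_b t q b = 0) -> (forall b, \sum_q t q b = 0) ->
  (forall q b, (frank u q < frank u p)%N -> t q b = 0) ->
  (forall b, (vrank u b < vrank u a)%N -> t p b = 0) ->
  ~~ (0 < t p a).
Proof.
move=> /goodP [_ _ sA] /goodP [_ _ sB] tB row col t0 tp0; apply/negP => tpa.
have [b ba tb] := signed_sum0 (row p) tpa.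
have ab : (vrank u a < vrank u b)%N.
  rewrite ltn_neqAle; apply/andP; split.
    by apply: contra ba => /eqP/vrank_inj ->.
  by rewrite leqNgt; apply: contraL tb => /tp0 ->; rewrite ltxx.
suff: 0 < \sum_q t q a by rewrite col ltxx.
rewrite (bigD1 p) //=; apply: ltr_wpDr => //; apply: sumr_ge0 => q qp.
have [lt|] := ltnP (frank u q) (frank u p); first by rewrite t0.
rewrite leq_eqVlt => /orP [/eqP/frank_inj e|pq]; first by rewrite e eqxx in qp.
rewrite leNgt; apply/negP => tqa.
have /= := sB (p, b) (q, a) (tB _ _ tb) (tB _ _ tqa) pq.
by rewrite leqNgt ab.
Qed.

(** Applied to the difference of two decompositions of a point: the map that sends
    a point of a product of simplices to the sum of its components is injective, even
    across two cells of the same window. *)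
Lemma sep_unique u (A B : {set 'I_d * 'I_n}) t :
  good u A -> good u B ->
  (forall q b, 0 < t q b -> (q, b) \in A) ->
  (forall q b, t q b < 0 -> (q, b) \in B) ->
  (forall q, \sum_b t q b = 0) -> (forall b, \sum_q t q b = 0) ->
  forall p a, t p a = 0.
Proof.
move=> gA gB tA tB row col p.
have [k] := ubnP (frank u p); elim: k p => // k IHk p; rewrite ltnS => pk a.
have [l] := ubnP (vrank u a); elim: l a => // l IHl a; rewrite ltnS => al.
have t0 q b : (frank u q < frank u p)%N -> t q b = 0.
  by move=> qp; apply: IHk; exact: leq_trans pk.
have tp0 b : (vrank u b < vrank u a)%N -> t p b = 0.
  by move=> ba; apply: IHl; exact: leq_trans al.
have := sep_first gA gB tB row col t0 tp0.
have := @sep_first u B A (fun q b => - t q b) p a gB gA.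
case: (ltgtP (t p a) 0) => // tn h _.
suff: ~~ (0 < - t p a) by rewrite oppr_gt0 tn.
apply: h => [q b|q|b|q b /t0 ->|b /tp0 ->]; rewrite ?oppr0 //.
- by rewrite oppr_lt0; exact: tA.
- by rewrite sumrN row oppr0.
- by rewrite sumrN col oppr0.
Qed.

(** The cyclic interval from [u], excluded, to [u']. *)
Definition in_arc (u u' : 'I_n) (a : 'I_n) := (vrank u a <= vrank u u')%N.

Lemma window_in_arc u u' p a : in_arc u u' (s p) -> (p, a) \in window u ->
  in_arc u u' a.
Proof.
rewrite !window_vrank /in_arc /vrank /=.
move: (ltn_ord a) (ltn_ord u) (ltn_ord (s p)) (ltn_ord u').
by do !case: ifP; lia.
Qed.

Lemma window_out_arc u u' p a : ~~ in_arc u u' (s p) -> (p, a) \in window u ->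
  ~~ in_arc u u' a -> (p, a) \in window u'.
Proof.
rewrite !window_vrank /in_arc /vrank /=.
move: (ltn_ord a) (ltn_ord u) (ltn_ord (s p)) (ltn_ord u').
by do !case: ifP; lia.
Qed.

Lemma arc_window u u' p a : in_arc u u' (s p) -> (p, a) \in window u ->
  (p, a) \in window u'.
Proof.
rewrite !window_vrank /in_arc /vrank /=.
move: (ltn_ord a) (ltn_ord u) (ltn_ord (s p)) (ltn_ord u').
by do !case: ifP; lia.
Qed.

Lemma window_not_arc u u' p a : ~~ in_arc u u' (s p) -> (p, a) \in window u' ->
  ~~ in_arc u u' a.
Proof.
rewrite !window_vrank /in_arc /vrank /=.
move: (ltn_ord a) (ltn_ord u) (ltn_ord (s p)) (ltn_ord u').
by do !case: ifP; lia.
Qed.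

(** Factors in the arc from u to u' have, in the window of u, all their mass in that
    arc; factors outside have, in the window of u', no mass in it. As [y] and [z] have
    the same total mass in the arc, both estimates are sharp, so [y] has no mass in the
    arc outside the factors that belong to it; that is the window condition for u'. *)
Lemma mass_window u u' y z :
  (forall p a, 0 <= y p a) -> (forall p a, 0 <= z p a) ->
  (forall p, \sum_a y p a = 1) -> (forall p, \sum_a z p a = 1) ->
  (forall p a, y p a != 0 -> (p, a) \in window u) ->
  (forall p a, z p a != 0 -> (p, a) \in window u') ->
  (forall a, \sum_p y p a = \sum_p z p a) ->
  forall p a, y p a != 0 -> (p, a) \in window u'.
Proof.
move=> y0 z0 y1 z1 yw zw yz.
pose I p := in_arc u u' (s p).
have yI p : I p -> \sum_(a | in_arc u u' a) y p a = 1.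
  move=> Ip; rewrite -(y1 p) [RHS](bigID (in_arc u u')) /= [X in _ + X]big1 ?addr0 //.
  by move=> a na; apply/eqP; apply: contraNT na => /yw; exact: window_in_arc.
have zI p : ~~ I p -> \sum_(a | in_arc u u' a) z p a = 0.
  move=> Ip; apply: big1 => a; apply: contraTeq => /zw.
  exact: window_not_arc.
have zle p : \sum_(a | in_arc u u' a) z p a <= 1.
  by rewrite -(z1 p) [leRHS](bigID (in_arc u u')) /= lerDl sumr_ge0.
have tot : \sum_p \sum_(a | in_arc u u' a) y p a
         = \sum_p \sum_(a | in_arc u u' a) z p a.
  by rewrite exchange_big [RHS]exchange_big /=; apply: eq_bigr => a _.
rewrite (bigID I) [RHS](bigID I) /= [X in _ = _ + X]big1 // addr0 in tot.
have le1 : \sum_(p | I p) \sum_(a | in_arc u u' a) z p a <=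
       \sum_(p | I p) \sum_(a | in_arc u u' a) y p a.
  by apply: ler_sum => p Ip; rewrite (yI p Ip).
have yout : \sum_(p | ~~ I p) \sum_(a | in_arc u u' a) y p a = 0.
  apply/eqP; rewrite eq_le sumr_ge0 ?andbT; last by move=> *; exact: sumr_ge0.
  by rewrite -(lerD2l (\sum_(p | I p) \sum_(a | in_arc u u' a) y p a)) addr0 tot.
move=> p a ya; have [Ip|Ip] := boolP (I p).
  by apply: arc_window Ip _; exact: yw.
apply: (window_out_arc Ip (yw _ _ ya)); apply: contraNN ya => ia.
have /eqP := yout; rewrite psumr_eq0; last by move=> *; exact: sumr_ge0.
move=> /allP /(_ p (mem_index_enum _)); rewrite Ip /= psumr_eq0 //.
by move=> /allP /(_ a (mem_index_enum _)); rewrite ia.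
Qed.

(** The geometric heart: a point of the realization has only one decomposition, so
    cells coming from different orders intersect as their labels do. *)
Lemma good_unique u u' (A B : {set 'I_d * 'I_n}) y z :
  good u A -> good u' B ->
  (forall p a, 0 <= y p a) -> (forall p a, 0 <= z p a) ->
  (forall p, \sum_a y p a = 1) -> (forall p, \sum_a z p a = 1) ->
  (forall p a, y p a != 0 -> (p, a) \in A) ->
  (forall p a, z p a != 0 -> (p, a) \in B) ->
  (forall a, \sum_p y p a = \sum_p z p a) ->
  forall p a, y p a = z p a.
Proof.
move=> gA gB y0 z0 y1 z1 yA zB yz p a.
have wA : A \subset window u by case/and3P: gA.
have wB : B \subset window u' by case/and3P: gB.
have yw := mass_window y0 z0 y1 z1
  (fun p a h => subsetP wA _ (yA p a h)) (fun p a h => subsetP wB _ (zB p a h)) yz.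
pose A' := A :&: window u'.
have gA' : good u' A'.
  apply: (@good_window u); last exact: subsetIr.
  apply: good_sub gA (subsetIl _ _) _; apply/fullP => q.
  have [b yb|h] := pickP (fun b => y q b != 0).
    by exists b; rewrite inE (yA _ _ yb) (yw _ _ yb).
  have := y1 q; rewrite big1 => [/eqP|b _]; first by rewrite eq_sym oner_eq0.
  by have /negbFE/eqP := h b.
apply/eqP; rewrite -subr_eq0; apply/eqP.
apply: (@sep_unique u' A' B (fun p a => y p a - z p a) gA' gB) => [q b h|q b h|q|b].
- have yb : y q b != 0.
    by apply: contraTneq h => ->; rewrite sub0r oppr_gt0 -leNgt.
  by rewrite inE (yA _ _ yb) (yw _ _ yb).
- by apply: zB; apply: contraTneq h => ->; rewrite subr0 -leNgt.
- by rewrite sumrB y1 z1 subrr.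
- by rewrite sumrB yz subrr.
Qed.

End Uniqueness.
End LabelledCells.

(** * Monomials as choices *)

Section FactorLists.
Variable n : nat.

Definition factors (v : 'X_{1..n}) : seq 'I_n :=
  flatten [seq nseq (v a) a | a <- enum 'I_n].

Lemma count_factors v a : count_mem a (factors v) = v a.
Proof.
rewrite /factors count_flatten -map_comp sumnE big_map big_enum /=.
rewrite (bigD1 a) //= count_nseq /= eqxx mul1n big1 ?addn0 // => b ba.
by rewrite count_nseq /= (negPf ba) mul0n.
Qed.

Lemma size_factors v : size (factors v) = mdeg v.
Proof.
rewrite /factors size_flatten /shape -map_comp sumnE big_map big_enum mdegE /=.
by apply: eq_bigr => a _; rewrite size_nseq.
Qed.

Lemma sum_mnm1E (l : seq 'I_n) a : (\sum_(b <- l) U_(b))%MM a = count_mem a l.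
Proof.
rewrite mnm_sumE -sum1_count [RHS]big_mkcond /=; apply: eq_bigr => b _.
by rewrite mnm1E; case: (b == a).
Qed.

Lemma perm_factors (l : seq 'I_n) : perm_eq (factors (\sum_(b <- l) U_(b))%MM) l.
Proof. by apply/allP => a _ /=; rewrite count_factors sum_mnm1E. Qed.

Lemma sum_factors v : (\sum_(b <- factors v) U_(b))%MM = v.
Proof. by apply/mnmP => a; rewrite sum_mnm1E count_factors. Qed.

Lemma sorted_factors (d : nat) (v : 'X_{1..n}) : mdeg v = d ->
  exists2 t : 'I_d -> 'I_n, forall p q : 'I_d, p <= q -> t p <= t q
    & (\sum_p U_(t p))%MM = v.
Proof.
move=> vd; pose l := sort (fun a b : 'I_n => a <= b) (factors v).
have ls : size l == d by rewrite size_sort size_factors vd.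
have tot : total (fun a b : 'I_n => a <= b) by move=> a b; exact: leq_total.
have tr : transitive (fun a b : 'I_n => a <= b) by move=> a b c; exact: leq_trans.
exists (tnth (Tuple ls)) => [p q pq|].
  have a0 : 'I_n := tnth (Tuple ls) p.
  have inl (r : 'I_d) : (r : nat) \in [pred i | i < size l] by rewrite inE (eqP ls).
  rewrite !(tnth_nth a0) /=.
  apply: (sorted_leq_nth tr _ a0 (sort_sorted tot (factors v)) _ _ (inl p) (inl q) pq).
  by move=> a; exact: leqnn.
rewrite -(big_tuple _ _ (Tuple ls) predT (fun b => U_(b)%MM)) /= -[RHS]sum_factors.
by apply/perm_big; rewrite perm_sort.
Qed.

End FactorLists.

Section Choices.
Variables (n d : nat) (s : 'I_d -> 'I_n).
Hypothesis s_mono : forall p q : 'I_d, p <= q -> s p <= s q.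

Local Notation choice := {ffun 'I_d -> 'I_n}.
Implicit Types (A B : {set 'I_d * 'I_n}) (c : choice).

Definition mon c : 'X_{1..n} := (\sum_p U_(c p))%MM.

Lemma mdeg_mon c : mdeg (mon c) = d.
Proof.
rewrite /mon mdeg_sum (eq_bigr (fun=> 1)) => [|p _]; last exact: mdeg1.
by rewrite sum1_card card_ord.
Qed.

Lemma monE c a : mon c a = #|[set p | c p == a]|.
Proof.
rewrite /mon mnm_sumE -sum1_card [RHS]big_mkcond; apply: eq_bigr => p _.
by rewrite mnm1E inE; case: eqP.
Qed.

Lemma bmon_subproof c : mdeg (mon c) < d.+1.
Proof. by rewrite mdeg_mon. Qed.

Definition bmon c : 'X_{1..n < d.+1} := BMultinom (bmon_subproof c).

Definition selects c A : bool := [forall p, (p, c p) \in A].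

(** A cell is identified with the set of exponent vectors of its vertices; a vertex
    chooses one variable in each of the sets A_p. *)
Definition cell A : {set 'X_{1..n < d.+1}} := [set bmon c | c in selects^~ A].

Definition graph c : {set 'I_d * 'I_n} := [set x | c x.1 == x.2].

Lemma in_graph c p a : ((p, a) \in graph c) = (c p == a).
Proof. by rewrite inE. Qed.

Lemma selectsP c A : reflect (forall p, (p, c p) \in A) (selects c A).
Proof. exact: forallP. Qed.

Lemma selects_graph c A : selects c A = (graph c \subset A).
Proof.
apply/selectsP/subsetP => h; last by move=> p; apply: h; rewrite in_graph.
by move=> [p a]; rewrite in_graph => /eqP <-.
Qed.

Lemma graph_full c : full (graph c).
Proof. by apply/fullP => p; exists (c p); rewrite in_graph. Qed.

Lemma selects_graphE c c' : selects c' (graph c) = (c' == c).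
Proof.
apply/selectsP/eqP => [h|-> p]; last by rewrite in_graph.
by apply/ffunP => p; apply/esym/eqP; rewrite -in_graph.
Qed.

Lemma cellP v A : reflect (exists2 c, selects c A & v = bmon c) (v \in cell A).
Proof. by apply: (iffP imsetP) => -[c cA ->]; exists c. Qed.

Lemma cell_graph c : cell (graph c) = [set bmon c].
Proof.
apply/setP => v; rewrite inE; apply/cellP/eqP => [[c']|->].
  by rewrite selects_graphE => /eqP ->.
by exists c; rewrite ?selects_graphE.
Qed.

Lemma cellS A B : A \subset B -> cell A \subset cell B.
Proof.
move=> AB; apply/subsetP => v /cellP [c cA ->]; apply/cellP; exists c => //.
by rewrite selects_graph (subset_trans _ AB) // -selects_graph.
Qed.

Lemma full_select A p a : full A -> (p, a) \in A ->
  exists2 c, selects c A & c p = a.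
Proof.
move=> /fullP /fin_all_exists [f fA] pA.
exists [ffun q => if q == p then a else f q]; last by rewrite ffunE eqxx.
by apply/selectsP => q; rewrite ffunE; case: eqP => [->|].
Qed.

Lemma full_select0 A : full A -> exists c, selects c A.
Proof.
move=> /fullP /fin_all_exists [f fA]; exists (finfun f).
by apply/selectsP => q; rewrite ffunE.
Qed.

Lemma selects_full A c : selects c A -> full A.
Proof. by move=> /selectsP h; apply/fullP => p; exists (c p). Qed.

Lemma cell0 A : full A -> cell A != set0.
Proof.
by move=> /full_select0 [c cA]; apply/set0Pn; exists (bmon c); apply/cellP; exists c.
Qed.

Section Indicator.
Local Open Scope ring_scope.

Lemma sum_pred1 (R : pzSemiRingType) (b : 'I_n) : \sum_a (b == a)%:R = 1 :> R.
Proof.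
rewrite (bigD1 b) //= eqxx big1 ?addr0 // => a.
by rewrite eq_sym => /negPf ->.
Qed.

(** The vertex of a choice, as a point of the product of simplices. *)
Definition indicator c (p : 'I_d) (a : 'I_n) : rat := (c p == a)%:R.

Lemma indicator_ge0 c p a : 0 <= indicator c p a.
Proof. exact: ler0n. Qed.

Lemma indicator_row c p : \sum_a indicator c p a = 1.
Proof. exact: sum_pred1. Qed.

Lemma indicator_col c a : \sum_p indicator c p a = (mon c a)%:R.
Proof. by rewrite /mon mnm_sumE natr_sum; apply: eq_bigr => p _; rewrite mnm1E. Qed.

Lemma indicator_supp c (W : {set 'I_d * 'I_n}) : (forall p, (p, c p) \in W) ->
  forall p a, indicator c p a != 0 -> (p, a) \in W.
Proof.
by move=> cW p a; rewrite /indicator; case: (c p =P a) => [<- _|]; rewrite ?eqxx.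
Qed.

End Indicator.

(** A vertex label determines the labelling, whatever the orders involved: this makes
    the labelled cells a faithful description of the faces. *)
Lemma mon_unique u u' A B c c' : good s u A -> good s u' B ->
  selects c A -> selects c' B -> mon c = mon c' -> c = c'.
Proof.
move=> gA gB /selectsP cA /selectsP cB cc; apply/ffunP => p.
have := good_unique s_mono gA gB (indicator_ge0 c) (indicator_ge0 c')
  (indicator_row c) (indicator_row c') (indicator_supp cA) (indicator_supp cB).
move=> /(_ _ p (c p)) h; have /eqP : indicator c p (c p) = indicator c' p (c p).
  by apply: h => a; rewrite !indicator_col cc.
by rewrite /indicator eqxx; case: (c' p =P c p) => [-> //|_]; rewrite oner_eq0.
Qed.

Lemma cell_subset u u' A B : good s u A -> good s u' B ->
  cell A \subset cell B -> A \subset B.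
Proof.
move=> gA gB /subsetP AB; apply/subsetP => -[p a] pA.
have fA : full A by case/and3P: gA.
have [c cA <-] := full_select fA pA.
have /cellP [c' cB e] : bmon c \in cell B by apply: AB; apply/cellP; exists c.
rewrite (mon_unique gA gB cA cB (congr1 val e)); exact/selectsP.
Qed.

Lemma cell_inj u u' A B : good s u A -> good s u' B -> cell A = cell B -> A = B.
Proof.
move=> gA gB AB; apply/eqP; rewrite eqEsubset.
by rewrite (cell_subset gA gB) ?AB // (cell_subset gB gA) ?AB.
Qed.

(** A cyclic shift argument. List the variables of [v] in increasing order and extend
    them to a sequence T with period (d, n). Among the shifts D for which T (p + D)
    does not exceed the level of [s p], take the largest one: the next shift exceeds the
    level of some [s w], and this is the window condition at [s w]. *)
Lemma good_choice_exists (v : 'X_{1..n}) : 0 < d -> mdeg v = d ->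
  exists w c, good s (s w) (graph c) /\ mon c = v.
Proof.
move=> d0 /sorted_factors [t t_mono <-].
have dmod k : k %% d < d by rewrite ltn_mod.
pose tm k := t (Ordinal (dmod k)).
pose T k := tm k + k %/ d * n.
have Tmono k l : k <= l -> T k <= T l.
  move=> kl; rewrite /T /tm; move: (ltn_ord (t (Ordinal (dmod k)))).
  have := leq_div2r d kl; rewrite leq_eqVlt => /orP [/eqP e|lt].
    have : k %% d <= l %% d by move: kl; rewrite {1}(divn_eq k d) {1}(divn_eq l d) e; lia.
    by move=> h; rewrite e leq_add2r; have := t_mono (Ordinal (dmod k)) (Ordinal (dmod l)) h.
  by nia.
have TD k : T (k + d) = T k + n.
  rewrite /T /tm divnDr ?dvdnn // divnn d0 mulnDl mul1n addnA; congr (_ + _ + _).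
  by congr (nat_of_ord (t _)); apply/val_inj; rewrite /= modnDr.
(* D = 0 is admissible, and a shift by more than 2 d adds at least 2 n to some T. *)
pose ok D := [forall q : 'I_d, T (q + D) <= s q + n].
have ok0 : exists D, ok D.
  exists 0; apply/forallP => q; rewrite addn0 /T divn_small //.
  by move: (ltn_ord (tm q)); lia.
have okb D : ok D -> D <= d + d.
  move=> /forallP /(_ (Ordinal d0)) /=; apply: contraTT; rewrite -!ltnNge add0n => h.
  have : T (0 + d + d) <= T D by apply: Tmono; lia.
  by rewrite !TD; move: (ltn_ord (s (Ordinal d0))); lia.
case: (ex_maxnP ok0 okb) => D /forallP okD maxD.
have /forallPn [w] : ~~ ok D.+1 by apply/negP => /maxD; rewrite ltnn.
rewrite -ltnNge => wD.
pose c : choice := [ffun q : 'I_d => tm (q + D)].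
exists w, c.
have low (q : 'I_d) : if s w < s q then s w + n < T (q + D) else s w < T (q + D).
  case: ifP => [wq|_].
    have lt : (w + D.+1) <= q + D.
      rewrite addnS ltn_add2r ltnNge; apply/negP => /s_mono; lia.
    by apply: leq_trans wD _; exact: Tmono.
  have : T (w + D.+1) <= T (q + D + d) by apply: Tmono; move: (ltn_ord w); lia.
  by rewrite TD; lia.
have lvl (q : 'I_d) : level s (q, c q) = T (q + D).
  rewrite /level /= /c ffunE; move: (okD q) (low q); rewrite /T.
  move: (ltn_ord (s q)) (ltn_ord (s w)) (ltn_ord (tm (q + D))).
  move: (nat_of_ord (tm (q + D))) ((q + D) %/ d) => x k.
  by case: k => [|[|k]]; do !case: ifP; lia.
split.
  apply/and3P; split; first exact: graph_full.
    apply/separatedP => -[p a] [q b]; rewrite !in_graph /= => /eqP <- /eqP <- pq.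
    rewrite !lvl -TD; move: (ltn_ord q) => qd.
    by apply/andP; split; apply: Tmono; lia.
  apply/subsetP => -[q a]; rewrite in_graph => /eqP <-.
  by rewrite inE /= lvl; exact: low.
rewrite /mon [RHS](reindex_inj (h := fun q : 'I_d => Ordinal (dmod (q + D)))) /=.
  by apply: eq_bigr => q _; rewrite ffunE.
move=> p q /(congr1 val) /= /eqP; rewrite eqn_modDr !modn_small // => /eqP h.
exact/val_inj.
Qed.

Lemma level_inj (p : 'I_d) (a b : 'I_n) : level s (p, a) = level s (p, b) -> a = b.
Proof.
rewrite /level /= => h; apply/val_inj => /=; move: h (ltn_ord a) (ltn_ord b).
by do !case: ifP; lia.
Qed.

(** The windows only bound levels from below and a maximum of increasing sequences is
    increasing, so the maximum of two good choices is good. All occurrences of a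
    variable in the maximum are occurrences in one and the same of the two choices, so
    its exponent does not exceed the larger of the two exponents. *)
Lemma good_choice_max u u' c c' (mu : 'X_{1..n}) :
  good s u (graph c) -> good s u' (graph c') ->
  (mon c <= mu)%MM -> (mon c' <= mu)%MM ->
  exists c'' : choice, [/\ good s u (graph c''), (mon c'' <= mu)%MM
    & forall p, level s (p, c'' p) = maxn (level s (p, c p)) (level s (p, c' p))].
Proof.
move=> /and3P [_ /separatedP sc /subsetP wc] /and3P [_ /separatedP sc' _] le le'.
pose e : choice := [ffun p => if level s (p, c p) <= level s (p, c' p) then c' p else c p].
have eE p : level s (p, e p) = maxn (level s (p, c p)) (level s (p, c' p)).
  by rewrite ffunE; case: leqP.
have ec p : e p = c p \/ e p = c' p by rewrite ffunE; case: ifP; [right|left].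
exists e; split=> //.
  apply/and3P; split; first exact: graph_full.
    apply/separatedP => -[p a] [q b]; rewrite !in_graph /= => /eqP <- /eqP <- pq.
    have := sc (p, c p) (q, c q); have := sc' (p, c' p) (q, c' q).
    rewrite !in_graph !eqxx => /(_ isT isT pq) h' /(_ isT isT pq) h.
    rewrite !eE; move: h h'.
    move: (level s (p, c p)) (level s (q, c q)) => x y.
    by move: (level s (p, c' p)) (level s (q, c' q)) => x' y'; lia.
  apply/subsetP => -[q a]; rewrite in_graph => /eqP <-.
  have := wc (q, c q); rewrite in_graph eqxx => /(_ isT).
  rewrite !inE /= eE; move: (level s (q, c q)) (level s (q, c' q)) => x x'.
  by case: ifP; lia.
apply/mnm_lepP => a.
(* An occurrence p of a that is only in c' and an occurrence q that is only in c would
   contradict the separation of c or of c', according to the order of p and q. *)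
have key : ([set p | e p == a] \subset [set p | c p == a]) ||
           ([set p | e p == a] \subset [set p | c' p == a]).
  apply: contraT; rewrite negb_or => /andP [/subsetPn [p] + + /subsetPn [q]].
  rewrite !inE => /eqP ep cp /eqP eq cq.
  have c'p : c' p = a by case: (ec p) => h; move: cp; rewrite -ep h ?eqxx.
  have c'q : c q = a by case: (ec q) => h; move: cq; rewrite -eq h ?eqxx.
  have lp := eE p; have lq := eE q; rewrite ep c'p in lp; rewrite eq c'q in lq.
  have npq : p != q :> nat.
    by apply: contraNneq cp => /val_inj ->; rewrite c'q.
  have np : level s (p, c p) != level s (p, a) by apply: contraNneq cp => /level_inj ->.
  have nq : level s (q, c' q) != level s (q, a) by apply: contraNneq cq => /level_inj ->.
  have S1 := sc (p, c p) (q, c q); have S2 := sc' (p, c' p) (q, c' q).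
  have S3 := sc (q, c q) (p, c p); have S4 := sc' (q, c' q) (p, c' p).
  rewrite !in_graph !eqxx /= in S1 S2 S3 S4.
  have {S1}S1 := S1 isT isT; have {S2}S2 := S2 isT isT.
  have {S3}S3 := S3 isT isT; have {S4}S4 := S4 isT isT.
  have la (r : 'I_d) : level s (r, a) = if a <= s r then a + n else a by [].
  have m1 := @s_mono p q; have m2 := @s_mono q p.
  rewrite c'p in S2 S4; rewrite c'q in S1 S3.
  move: lp lq np nq S1 S2 S3 S4; rewrite !la.
  move: (level s (p, c p)) (level s (q, c' q)) => x y.
  by have [pq|pq|pq] := ltngtP p q; [| |by rewrite pq eqxx in npq]; do !case: ifP; lia.
move: le le' => /mnm_lepP /(_ a) le /mnm_lepP /(_ a) le'.
rewrite monE; case/orP: key => /subset_leq_card h.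
  by apply: leq_trans h _; rewrite -monE.
by apply: leq_trans h _; rewrite -monE.
Qed.

End Choices.

(** * Faces, dimension and intersections of cells *)

Section Geometry.
Variables (R : realFieldType) (n d : nat) (s : 'I_d -> 'I_n).
Hypothesis s_mono : forall p q : 'I_d, p <= q -> s p <= s q.
Local Open Scope ring_scope.

Local Notation choice := {ffun 'I_d -> 'I_n}.
Local Notation vset := {set 'X_{1..n < d.+1}}.
Implicit Types (A B : {set 'I_d * 'I_n}) (c : choice).

Lemma linear_mon (a : 'I_n -> R) c :
  \sum_j a j * (mon c j)%:R = \sum_p a (c p).
Proof.
under eq_bigr => j _ do rewrite /mon mnm_sumE natr_sum mulr_sumr.
rewrite exchange_big /=; apply: eq_bigr => p _.
rewrite (bigD1 (c p)) //= mnm1E eqxx mulr1 big1 ?addr0 // => j.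
by rewrite mnm1E eq_sym => /negPf ->; rewrite mulr0.
Qed.

Lemma set0_face (V : vset) : face_of R V set0.
Proof.
exists (fun=> 0), 1; split=> [v _|].
  by rewrite big1 ?ler01 // => j _; rewrite mul0r.
apply/setP => v; rewrite !inE big1 ?[0 == 1]eq_sym ?oner_eq0 ?andbF // => j _.
by rewrite mul0r.
Qed.

(** A linear form is maximal at a vertex if and only if it is maximal in each
    component. *)
Lemma face_cell_inv A W : face_of R (cell A) W ->
  W = set0 \/ exists B, [/\ full B, B \subset A & W = cell B].
Proof.
move=> [a [k [le ->]]]; set V := [set v in _ | _].
have [->|[v0]] := set_0Vmem V; [by left | rewrite inE => /andP[]].
move=> /cellP [c0 c0A ->] /eqP; rewrite /= linear_mon => c0k; right.
have lek c : selects c A -> \sum_p a (c p) <= k.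
  by move=> cA; rewrite -linear_mon; apply: le (bmon c) _; apply/cellP; exists c.
pose B := [set x in A | [forall y in A, (y.1 == x.1) ==> (a y.2 <= a x.2)]].
have opt c : selects c A -> \sum_p a (c p) = k -> selects c B.
  move=> cA ck; apply/selectsP => p; rewrite inE (selectsP _ _ cA) /=.
  apply/forall_inP => -[q b] qA /=; apply/implyP => /eqP qp; rewrite qp in qA.
  pose c' : choice := [ffun q => if q == p then b else c q].
  have /lek : selects c' A.
    by apply/selectsP => r; rewrite ffunE; case: eqP => [->|_] //; exact/selectsP.
  rewrite -ck (bigD1 p) //= [leRHS](bigD1 p) //= ffunE eqxx.
  rewrite (eq_bigr (fun r => a (c r))) ?lerD2r // => r rp.
  by rewrite ffunE (negPf rp).
have BA : B \subset A by apply/subsetP => x; rewrite inE => /andP[].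
exists B; split=> //; first exact: selects_full (opt _ c0A c0k).
apply/setP => v; rewrite inE; apply/andP/idP.
  move=> [/cellP [c cA ->]]; rewrite linear_mon => /eqP ck.
  by apply/cellP; exists c => //; exact: opt.
move=> vB; split; first exact: (subsetP (cellS BA)).
have /cellP [c /selectsP cB ->] := vB; rewrite linear_mon eq_le lek /=; last first.
  by apply/selectsP => p; exact: (subsetP BA).
rewrite -c0k; apply: ler_sum => p _.
have := cB p; rewrite inE => /andP [_ /forall_inP /(_ (p, c0 p))].
by rewrite eqxx /=; apply; exact/selectsP.
Qed.

Lemma extremes u A : full A -> exists lh : 'I_d -> 'I_n * 'I_n, forall p,
  [/\ (p, (lh p).1) \in A, (p, (lh p).2) \in A &
    forall a, (p, a) \in A ->
      (vrank u (lh p).1 <= vrank u a <= vrank u (lh p).2)%N].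
Proof.
move=> /fullP fA.
suff h p : exists l : 'I_n * 'I_n, [/\ (p, l.1) \in A, (p, l.2) \in A &
    forall a, (p, a) \in A -> (vrank u l.1 <= vrank u a <= vrank u l.2)%N].
  exact: fin_all_exists h.
have [a0 pa0] := fA p.
case: (arg_minnP (P := fun a => (p, a) \in A) (vrank u) pa0) => lo loA lo_min.
case: (arg_maxnP (P := fun a => (p, a) \in A) (vrank u) pa0) => hi hiA hi_max.
exists (lo, hi); split=> // a pa; rewrite lo_min //=; exact: hi_max.
Qed.

(** The linear form is a sum over the factors p of the indicator of B_p, extended from
    the range of A_p to all variables by clamping. As the sets A_p are weakly
    increasing, the term of p is constant on A_q for q other than p, so the sum is
    maximal exactly on B. *)
Lemma face_cell u A B : good s u A -> full B -> B \subset A ->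
  face_of R (cell A) (cell B).
Proof.
move=> gA fB BA; have [fA _ sA] := goodP s_mono _ _ gA.
have [lh lhP] := extremes u (introT (fullP A) fA).
(* phi p is the clamped indicator of B_p; base q adds up the constants to which the
   other terms reduce on A_q. *)
pose phi p a : R := if (vrank u a <= vrank u (lh p).1)%N then ((p, (lh p).1) \in B)%:R
  else if (vrank u (lh p).2 <= vrank u a)%N then ((p, (lh p).2) \in B)%:R
  else ((p, a) \in B)%:R.
pose base q : R := \sum_(p | p != q)
  (if (frank s u q < frank s u p)%N then ((p, (lh p).1) \in B)%:R
   else ((p, (lh p).2) \in B)%:R).
have phi_own q a : (q, a) \in A -> phi q a = ((q, a) \in B)%:R.
  move=> qa; have [_ _ /(_ a qa) /andP [l h]] := lhP q; rewrite /phi.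
  case: leqP => [h1|_]; first by rewrite (@vrank_inj _ u (lh q).1 a) //; lia.
  by case: leqP => [h2|_] //; rewrite (@vrank_inj _ u (lh q).2 a) //; lia.
have phi_other p q a : (q, a) \in A -> p != q -> phi p a =
    if (frank s u q < frank s u p)%N then ((p, (lh p).1) \in B)%:R
    else ((p, (lh p).2) \in B)%:R.
  move=> qa pq; have [lA hA lh_le] := lhP p; rewrite /phi.
  have /andP [_ l_le_h] := lh_le _ lA.
  have npq : frank s u q != frank s u p.
    by apply: contraNneq pq => /frank_inj ->.
  case: ltngtP npq => // [lt _|lt _].
    by have /= -> := sA _ _ qa lA lt.
  have /= := sA _ _ hA qa lt => h; rewrite h; case: leqP => // h'.
  by rewrite (@vrank_inj _ u (lh p).1 (lh p).2) //; lia.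
pose al a := \sum_p phi p a.
have alE q a : (q, a) \in A -> al a = base q + ((q, a) \in B)%:R.
  move=> qa; rewrite /al (bigD1 q) //= phi_own // addrC; congr (_ + _).
  by apply: eq_bigr => p pq; exact: phi_other.
have valE c : selects c A ->
    \sum_j al j * (mon c j)%:R = \sum_q (base q + ((q, c q) \in B)%:R).
  by move=> /selectsP cA; rewrite linear_mon; apply: eq_bigr => q _; exact: alE.
have b1 (b : bool) : (b%:R <= 1 :> R) by case: b; rewrite ?ler01 ?lexx.
exists al, (\sum_q (base q + 1)); split.
  by move=> v /cellP [c cA ->]; rewrite valE //; apply: ler_sum => q _; rewrite lerD2l.
apply/setP => v; rewrite inE; apply/idP/andP.
  move=> vB; split; first exact: (subsetP (cellS BA)).
  have /cellP [c cB ->] := vB; have /selectsP cB' := cB.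
  rewrite valE; last by apply/selectsP => p; exact: (subsetP BA).
  by apply/eqP/eq_bigr => q _; rewrite cB'.
move=> [/cellP [c cA ->]]; rewrite valE // => /eqP tot.
apply/cellP; exists c => //; apply/selectsP => q.
have /eqP : \sum_q ((base q + 1) - (base q + ((q, c q) \in B)%:R)) = 0.
  by rewrite sumrB tot subrr.
rewrite psumr_eq0 => [|p _]; last by rewrite subr_ge0 lerD2l.
move=> /allP /(_ q (mem_index_enum _)) /=; case: ((q, c q) \in B) => //.
by rewrite addr0 addrC addKr oner_eq0.
Qed.

Lemma face_good u A W : good s u A -> face_of R (cell A) W <->
  W = set0 \/ exists B, [/\ full B, B \subset A & W = cell B].
Proof.
move=> gA; split; first exact: face_cell_inv.
by move=> [->|[B [fB BA ->]]]; [exact: set0_face | exact: face_cell gA fB BA].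
Qed.

(** ** Convex hulls *)

Lemma in_hullS (V W : vset) x : V \subset W -> in_hull V x -> in_hull (R := R) W x.
Proof.
move=> VW [w [w0 w1 ->]]; exists (fun v => if v \in V then w v else 0); split.
- by move=> v _; case: ifP => // /w0.
- by rewrite -big_mkcondr -w1; apply: eq_bigl => v; rewrite andb_idl //; exact: (subsetP VW).
rewrite [RHS](eq_bigr (fun v => if v \in V then w v *: point R v else 0)) => [|v _]; last first.
  by case: ifP; rewrite ?scale0r.
by rewrite -big_mkcondr; apply: eq_bigl => v; rewrite andb_idl //; exact: (subsetP VW).
Qed.

Lemma in_hull0 x : ~ in_hull (R := R) (set0 : vset) x.
Proof. by move=> [w [_ /eqP + _]]; rewrite big_set0 eq_sym oner_eq0. Qed.

(** The points of the product of the simplices spanned by the A_p. *)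
Definition spread A (y : 'I_d -> 'I_n -> R) : Prop :=
  [/\ forall p a, 0 <= y p a, forall p, \sum_a y p a = 1
    & forall p a, y p a != 0 -> (p, a) \in A].

Lemma point_mon c a : point R (mon c) 0 a = \sum_p (c p == a)%:R.
Proof. by rewrite mxE /mon mnm_sumE natr_sum; apply: eq_bigr => p _; rewrite mnm1E. Qed.

Lemma hull_spread A x : full A -> in_hull (cell A) x ->
  exists2 y, spread A y & forall a, x 0 a = \sum_p y p a.
Proof.
move=> /full_select0 [c0 c0A] [w [w0 w1 ->]].
pose ch v := odflt c0 [pick c | selects c A && (bmon c == v)].
have chP v : v \in cell A -> selects (ch v) A /\ bmon (ch v) = v.
  move=> /cellP [c cA ->]; rewrite /ch; case: pickP => [e /andP [eA /eqP]|/(_ c)] //.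
  by rewrite cA eqxx.
exists (fun p a => \sum_(v in cell A) w v * (ch v p == a)%:R); first split.
- by move=> p a; apply: sumr_ge0 => v vA; rewrite mulr_ge0 ?w0 ?ler0n.
- move=> p; rewrite exchange_big /= -[RHS]w1; apply: eq_bigr => v _.
  by rewrite -mulr_sumr sum_pred1 mulr1.
- move=> p a; apply: contraNT => pa; apply/eqP/big1 => v /chP [/selectsP/(_ p) vA _].
  by case: eqP => [e|]; rewrite ?mulr0 //; rewrite e (negPf pa) in vA.
move=> a; rewrite exchange_big /= summxE; apply: eq_bigr => v vA.
have [_ e] := chP v vA.
by rewrite mxE -mulr_sumr -point_mon; congr (_ * point R _ 0 a); rewrite -[in LHS]e.
Qed.

(** The product of the weights of the components is a convex combination of vertices
    with the right marginals. *)
Lemma spread_hull A y (x : 'rV[R]_n) : spread A y ->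
  (forall a, x 0 a = \sum_p y p a) -> in_hull (cell A) x.
Proof.
move=> [y0 y1 yA] xE.
pose wt (c : choice) := \prod_p y p (c p).
have wt0 (c : choice) : ~~ selects c A -> wt c = 0.
  move=> /forallPn [p pA]; rewrite /wt (bigD1 p) //=.
  suff -> : y p (c p) = 0 by rewrite mul0r.
  by apply/eqP; apply: contraNT pA; exact: yA.
have wt1 : \sum_(c : choice) wt c = 1.
  by rewrite -(bigA_distr_bigA y) big1 // => p _; exact: y1.
have margin p a : \sum_(c : choice | c p == a) wt c = y p a.
  have -> : \sum_(c : choice | c p == a) wt c =
            \sum_(c : choice) \prod_q (y q (c q) * ((q == p) ==> (c q == a))%:R).
    rewrite big_mkcond; apply: eq_bigr => c _; rewrite big_split /= -/(wt c).
    rewrite [X in _ = _ * X](bigD1 p) //= eqxx /= big1 => [|q /negPf -> //].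
    by case: eqP; rewrite ?mulr1 ?mul1r ?mulr0 ?mul0r.
  rewrite -(bigA_distr_bigA (fun q b => y q b * ((q == p) ==> (b == a))%:R)) /=.
  rewrite (bigD1 p) //= [X in _ * X]big1 ?mulr1 => [|q /negPf qp]; last first.
    by rewrite -[RHS](y1 q); apply: eq_bigr => b _; rewrite qp mulr1.
  rewrite (bigD1 a) //= !eqxx mulr1 big1 ?addr0 // => b /negPf ->.
  by rewrite mulr0.
(* Different choices may have the same monomial, so their weights are added. *)
pose w v := \sum_(c : choice | bmon c == v) wt c.
have w_out v : v \notin cell A -> w v = 0.
  move=> vA; apply: big1 => c /eqP cv; apply: wt0; apply: contraNN vA => cA.
  by apply/cellP; exists c.
exists w; split.
- by move=> v _; apply: sumr_ge0 => c _; apply: prodr_ge0 => p _.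
- rewrite -[RHS]wt1 (partition_big (fun c => bmon c) predT) //= [RHS](bigID (mem (cell A))) /=.
  by rewrite [X in _ = _ + X]big1 ?addr0 // => v; exact: w_out.
apply/rowP => a; rewrite xE summxE.
under eq_bigr => p _ do rewrite -margin big_mkcond.
rewrite exchange_big /= (partition_big (fun c => bmon c) predT) //=.
rewrite (bigID (mem (cell A))) /= [X in _ + X]big1 ?addr0 => [|v vA]; last first.
  apply: big1 => c /eqP cv; apply: big1 => p _; case: ifP => // _.
  by apply: wt0; apply: contraNN vA => cA; apply/cellP; exists c.
apply: eq_bigr => v _; rewrite mxE /w mulr_suml; apply: eq_bigr => c /eqP <-.
rewrite point_mon mulr_sumr; apply: eq_bigr => p _.
by case: eqP; rewrite ?mulr1 ?mulr0.
Qed.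

(** By uniqueness both decompositions of [x] agree, so that they live on the
    intersection of the labels. *)
Lemma hullI u u' A B x : good s u A -> good s u' B ->
  in_hull (cell A) x -> in_hull (cell B) x ->
  full (A :&: B) /\ in_hull (R := R) (cell (A :&: B)) x.
Proof.
move=> gA gB.
have fA : full A by case/and3P: gA.
have fB : full B by case/and3P: gB.
move=> /(hull_spread fA) [y [y0 y1 yA] xy] /(hull_spread fB) [z [z0 z1 zB] xz].
have yz : forall p a, y p a = z p a.
  by apply: (good_unique s_mono gA gB) => // a; rewrite -xy -xz.
have yAB p a : y p a != 0 -> (p, a) \in A :&: B.
  by move=> ya; rewrite inE yA // zB // -yz.
split; last by apply: spread_hull xy; split.
apply/fullP => p; have [a ya|h] := pickP (fun a => y p a != 0).
  by exists a; exact: yAB.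
have := y1 p; rewrite big1 => [/eqP|a _]; first by rewrite eq_sym oner_eq0.
by have /negbFE/eqP := h a.
Qed.

(** ** Dimension *)

Lemma mon_set c p a (c' := [ffun q => if q == p then a else c q] : choice) :
  point R (mon c') - point R (mon c) = delta_mx 0 a - delta_mx 0 (c p).
Proof.
apply/rowP => b; rewrite !mxE eqxx /= /mon !mnm_sumE !natr_sum -sumrB.
rewrite (bigD1 p) //= !mnm1E ffunE eqxx big1 ?addr0 => [|q /negPf qp]; last first.
  by rewrite !mnm1E ffunE qp subrr.
by rewrite !(eq_sym b).
Qed.

Lemma card_full_sum A : #|A| = (\sum_p #|[set a | (p, a) \in A]|)%N.
Proof.
rewrite -sum1_card (eq_bigr (fun p => \sum_(a | (p, a) \in A) 1)%N) => [|p _].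
  by rewrite pair_big_dep /=; apply: eq_bigl => -[].
by rewrite -sum1_card; apply: eq_bigl => a; rewrite inE.
Qed.

Lemma card_graph c : #|graph c| = d.
Proof.
rewrite card_full_sum (eq_bigr (fun=> 1%N)) ?sum1_card ?card_ord // => p _.
rewrite -(cards1 (c p)); congr #|pred_of_set _|.
by apply/setP => a; rewrite !inE eq_sym.
Qed.

(** The differences of vertices are spanned by the vectors e_a - e_(c0 p) for (p, a) in
    A off a fixed choice [c0]. A linear relation between those is a family with zero
    row and column sums, hence trivial by uniqueness of decompositions. *)
Lemma pdim_cell u A : good s u A -> pdim R (cell A) = (#|A| - d)%N.
Proof.
move=> gA; have fA : full A by case/and3P: gA.
have [c0 c0A] := full_select0 fA; have c0A' := selectsP _ _ c0A.
set A' := A :\: graph c0.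
have <- : #|A'| = (#|A| - d)%N.
  rewrite cardsD (setIidPr _) ?card_graph //.
  by rewrite -selects_graph.
pose E : 'M[R]_(#|A'|, n) := \matrix_(i < #|A'|)
  (delta_mx 0 (enum_val i).2 - delta_mx 0 (c0 (enum_val i).1)).
have diff v : v \in cell A -> (point R v - point R (mon c0) <= E)%MS.
  move=> /cellP [c /selectsP cA ->].
  have -> : point R (bmon c) - point R (mon c0) =
            \sum_p (delta_mx 0 (c p) - delta_mx 0 (c0 p)).
    apply/rowP => a; rewrite summxE !mxE /= /mon !mnm_sumE !natr_sum -sumrB.
    by apply: eq_bigr => p _; rewrite !mxE !mnm1E eqxx !(eq_sym a).
  apply: summx_sub => p _; have [->|cp] := eqVneq (c p) (c0 p).
    by rewrite subrr sub0mx.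
  have pA' : (p, c p) \in A' by rewrite !inE cA andbT /= eq_sym.
  have <- : row (enum_rank_in pA' (p, c p)) E = delta_mx 0 (c p) - delta_mx 0 (c0 p).
    by rewrite /E rowK enum_rankK_in.
  exact: row_sub.
have eqE : ((\sum_(v in cell A) \sum_(w in cell A) <<point R v - point R w>>)%MS :=: E)%MS.
  apply/eqmxP/andP; split.
    apply/sumsmx_subP => v vA; apply/sumsmx_subP => w wA; rewrite genmxE.
    have -> : point R v - point R w =
      (point R v - point R (mon c0)) - (point R w - point R (mon c0)).
      by rewrite opprB addrA subrK.
    by rewrite addmx_sub ?eqmx_opp ?diff.
  apply/row_subP => i; rewrite /E rowK.
  have := enum_valP i; case: (enum_val i) => p a /=; rewrite !inE /= => /andP [_ pa].
  rewrite -mon_set; set c' := finfun _.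
  apply: (sumsmx_sup (bmon c')).
    apply/cellP; exists c' => //; apply/selectsP => q; rewrite ffunE.
    by case: eqP => [->|].
  apply: (sumsmx_sup (bmon c0)); first by apply/cellP; exists c0.
  by rewrite genmxE.
rewrite /pdim eqE; apply/eqP; rewrite -/(row_free E); apply: inj_row_free => v vE.
(* The coefficients of the relation, completed at the elements of c0 so that the rows
   add up to zero. *)
pose t p a : R := \sum_i v 0 i *
  ((enum_val i == (p, a))%:R - ((enum_val i).1 == p)%:R * (c0 p == a)%:R).
have val1 (i : 'I_#|A'|) p : \sum_a (enum_val i == (p, a) :> 'I_d * 'I_n)%:R = ((enum_val
  i).1 == p)%:R :> R.
  case: (enum_val i) => q b /=; have [->|qp] := eqVneq q p.
    by rewrite -[RHS](sum_pred1 R b); apply: eq_bigr => a _; rewrite xpair_eqE eqxx.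
  by apply: big1 => a _; rewrite xpair_eqE (negPf qp).
have t_row p : \sum_a t p a = 0.
  rewrite /t exchange_big /=; apply: big1 => i _.
  by rewrite -mulr_sumr sumrB val1 -mulr_sumr sum_pred1 mulr1 subrr mulr0.
have t_col a : \sum_p t p a = 0.
  have vEa : \sum_j v 0 j * E j a = 0.
    by have := congr1 (fun x : 'rV_n => x 0 a) vE; rewrite mxE => ->; rewrite mxE.
  rewrite /t exchange_big -[RHS]vEa /=; apply: eq_bigr => i _; rewrite -mulr_sumr; congr (_ * _).
  rewrite !mxE eqxx /= !(eq_sym a); case: (enum_val i) => q b /=.
  rewrite sumrB; congr (_ - _); rewrite (bigD1 q) //= big1 ?addr0 => [|p /negPf pq].
  - by rewrite xpair_eqE eqxx.
  - by rewrite xpair_eqE eq_sym pq.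
  - by rewrite eqxx mul1r.
  - by rewrite eq_sym pq mul0r.
have tA p a : t p a != 0 -> (p, a) \in A.
  apply: contraNT => pa; apply/eqP/big1 => i _.
  have := enum_valP i; rewrite inE => /andP [_ iA].
  have -> : (enum_val i == (p, a)) = false by apply: contraNF pa => /eqP <-.
  case: (c0 p =P a) => [e|_]; last by rewrite mulr0 subrr mulr0.
  by move: pa; rewrite -e c0A'.
have t0 := sep_unique s_mono gA gA
  (fun q b h => tA q b (lt0r_neq0 h)) (fun q b h => tA q b (ltr0_neq0 h)) t_row t_col.
apply/rowP => i; rewrite mxE -[RHS](t0 (enum_val i).1 (enum_val i).2) /t.
rewrite (bigD1 i) //= -surjective_pairing !eqxx mul1r big1 ?addr0 => [|j ji].
  have := enum_valP i; rewrite !inE => /andP [/negPf -> _].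
  by rewrite subr0 mulr1.
rewrite (inj_eq enum_val_inj) (negPf ji) sub0r.
have := enum_valP i; rewrite !inE => /andP [/negPf -> _].
by rewrite mulr0 oppr0 mulr0.
Qed.

Lemma facet_cell u A W : good s u A -> facet_of R (cell A) W <->
  exists x, [/\ x \in A, full (A :\ x) & W = cell (A :\ x)].
Proof.
move=> gA; have good_card B : full B -> B \subset A -> (d <= #|B|)%N.
  move=> /full_select0 [c]; rewrite selects_graph => h _.
  by apply: leq_trans (subset_leq_card h); rewrite card_graph.
have fA : full A by case/and3P: gA.
split=> [[/(face_good _ gA) [-> //|[B [fB BA ->]]] _]|[x [xA fx ->]]].
  rewrite (pdim_cell gA) (pdim_cell (good_sub s_mono gA BA fB)) => cardE.
  have : #|A :\: B| = 1%N.
    have := good_card _ fB BA; have := good_card _ fA (subxx A).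
    have := cardsID B A; rewrite (setIidPr BA); lia.
  move=> /eqP /cards1P [x xE]; exists x.
  have /setDP [xA xB] : x \in A :\: B by rewrite xE set11.
  have -> : A :\ x = B.
    by rewrite -xE setDDr setDv set0U; exact/setIidPr.
  by [].
have sub := subsetDl A [set x].
split; first exact: face_cell gA fx sub.
  by apply/eqP; exact: cell0.
rewrite (pdim_cell gA) (pdim_cell (good_sub s_mono gA sub fx)).
have := good_card _ fx sub; rewrite (cardsD1 x A) xA; lia.
Qed.

(** ** Labels *)

Lemma labelE (V : vset) a : label V a = (\max_(v in V) (v : 'X_{1..n}) a)%N.
Proof.
apply: (big_morph (fun m : 'X_{1..n} => m a) _ (mnm0E _)) => u v.
by rewrite /mlcm mnmE.
Qed.

Definition colsums A : 'X_{1..n} := [multinom #|[set p | (p, a) \in A]| | a < n].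

Lemma colsumsS A B : A \subset B -> (colsums A <= colsums B)%MM.
Proof.
move=> /subsetP AB; apply/mnm_lepP => a; rewrite !mnmE.
by apply/subset_leq_card/subsetP => p; rewrite !inE; exact: AB.
Qed.

Lemma mon_colsums c A : selects c A -> (mon c <= colsums A)%MM.
Proof.
move=> /selectsP cA; apply/mnm_lepP => a; rewrite monE mnmE.
by apply/subset_leq_card/subsetP => p; rewrite !inE => /eqP <-.
Qed.

Lemma label_cell A : full A -> label (cell A) = colsums A.
Proof.
move=> fA; apply/mnmP => a; rewrite labelE; apply/eqP.
rewrite eqn_leq; apply/andP; split.
  by apply/bigmax_leqP => v /cellP [c /mon_colsums/mnm_lepP/(_ a) h ->].
have [c0 c0A] := full_select0 fA.
pose c : choice := [ffun p => if (p, a) \in A then a else c0 p].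
have cA : selects c A.
  by apply/selectsP => p; rewrite ffunE; case: ifP => // _; exact/selectsP.
apply: leq_trans (leq_bigmax_cond (bmon c) _); last by apply/cellP; exists c.
rewrite /= monE mnmE; apply/subset_leq_card/subsetP => p; rewrite !inE ffunE.
by move=> ->.
Qed.

Lemma labelS (V W : vset) : V \subset W -> (label V <= label W)%MM.
Proof.
move=> /subsetP VW; apply/mnm_lepP => a; rewrite !labelE.
by apply/bigmax_leqP => v /VW vW;
  exact: (leq_bigmax_cond (F := fun v : 'X_{1..n < d.+1} => (v : 'X_{1..n}) a)).
Qed.

(** This is what makes the resolution minimal. *)
Lemma label_remove A x : x \in A -> full (A :\ x) ->
  label (cell A) != label (cell (A :\ x)).
Proof.
case: x => q a xA fx; have fA : full A.
  by apply/fullP => p; have [b] := fullP _ fx p; rewrite inE => /andP [_]; exists b.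
rewrite !label_cell //; apply/eqP => /(congr1 (fun m : 'X_{1..n} => m a)).
rewrite !mnmE => /eqP; apply/negP; rewrite gtn_eqF //; apply/proper_card/properP.
split; first by apply/subsetP => p; rewrite !inE => /andP [].
by exists q; rewrite !inE ?xA // eqxx.
Qed.

End Geometry.

(** * The polytopal complex and its incidence functions *)

Section Complex.
Variables (R : realFieldType) (n d : nat) (s : 'I_d -> 'I_n).
Hypothesis s_mono : forall p q : 'I_d, p <= q -> s p <= s q.
Hypothesis d_gt0 : 0 < d.

Local Notation vset := {set 'X_{1..n < d.+1}}.
Implicit Types (A B : {set 'I_d * 'I_n}) (F G H : vset).

Definition good_cell A : bool := [exists w, good s (s w) A].

Variable X : vset -> Prop.
Hypothesis XP : forall F, X F <-> F = set0 \/ exists2 A, good_cell A & F = cell A.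

Lemma good_cell_full A : good_cell A -> full A.
Proof. by move=> /existsP [w /and3P []]. Qed.

Lemma good_cell_sub A B : good_cell A -> B \subset A -> full B -> good_cell B.
Proof. by move=> /existsP [w gA] BA fB; apply/existsP; exists w; apply: good_sub gA BA fB. Qed.

Lemma good_cell_inj A B : good_cell A -> good_cell B -> cell A = cell B -> A = B.
Proof. by move=> /existsP [w gA] /existsP [w' gB]; exact: (cell_inj s_mono gA gB). Qed.

Lemma face_good_cell A W : good_cell A -> face_of R (cell A) W <->
  W = set0 \/ exists B, [/\ full B, B \subset A & W = cell B].
Proof. by move=> /existsP [w gA]; exact: face_good gA. Qed.

Lemma facet_good_cell A W : good_cell A -> facet_of R (cell A) W <->
  exists x, [/\ x \in A, full (A :\ x) & W = cell (A :\ x)].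
Proof. by move=> /existsP [w gA]; exact: facet_cell gA. Qed.

Lemma pdim_good_cell A : good_cell A -> pdim R (cell A) = #|A| - d.
Proof. by move=> /existsP [w gA]; exact: pdim_cell gA. Qed.

Lemma X_cell A : good_cell A -> X (cell A).
Proof. by move=> gA; apply/XP; right; exists A. Qed.

Lemma full_card A : full A -> d <= #|A|.
Proof.
move=> /full_select0 [c]; rewrite selects_graph => h.
by apply: leq_trans (subset_leq_card h); rewrite card_graph.
Qed.

Lemma complex_polytopal : polytopal_complex R X.
Proof.
split.
- by apply/XP; left.
- move=> F v /XP [->|[A gA ->]]; first by rewrite inE.
  move=> /cellP [c cA ->]; rewrite -cell_graph; apply/(face_good_cell _ gA); right.
  by exists (graph c); rewrite graph_full -selects_graph.
- move=> F G /XP [->|[A gA ->]] FG.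
    case: FG => a [k [_ ->]]; apply/XP; left; apply/setP => v.
    by rewrite !inE.
  have [->|[B [fB BA ->]]] := (face_good_cell _ gA).1 FG; first by apply/XP; left.
  by apply: X_cell; exact: good_cell_sub BA fB.
move=> F G /XP [->|[A gA ->]].
  move=> _; exists set0; split; try exact: set0_face.
  by move=> x; split=> [[] //|h]; case: (in_hull0 h).
move=> /XP [->|[B gB ->]].
  exists set0; split; try exact: set0_face.
  by move=> x; split=> [[] //|h]; case: (in_hull0 h).
have /existsP [w gA'] := gA; have /existsP [w' gB'] := gB.
have [fAB|fAB] := boolP (full (A :&: B)).
  exists (cell (A :&: B)); split.
  - by apply/(face_good_cell _ gA); right; exists (A :&: B); rewrite subsetIl.
  - by apply/(face_good_cell _ gB); right; exists (A :&: B); rewrite subsetIr.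
  move=> x; split=> [[hA hB]|h]; first by case: (hullI s_mono gA' gB' hA hB).
  by split; apply: in_hullS h; apply: cellS; rewrite ?subsetIl ?subsetIr.
exists set0; split; try exact: set0_face.
move=> x; split=> [[hA hB]|h]; last by case: (in_hull0 h).
by case: (hullI s_mono gA' gB' hA hB) => f _; rewrite f in fAB.
Qed.

(** ** Existence of an incidence function *)
Local Open Scope ring_scope.

(** The lexicographic order on pairs. With the sign of the position of the removed
    pair, a labelled cell bounds like a simplex whose vertices are its pairs; the
    facets that would leave some A_p empty are missing, but whether two pairs can be
    removed does not depend on the order of removal. *)
Definition pair_key (x : 'I_d * 'I_n) : nat := (x.1 * n + x.2)%N.

Definition before A (x : 'I_d * 'I_n) : nat :=
  #|[set y in A | (pair_key y < pair_key x)%N]|.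

Lemma pair_key_inj : injective pair_key.
Proof.
move=> [p a] [q b]; rewrite /pair_key /= => e.
have := congr1 (divn^~ n) e; have := congr1 (modn^~ n) e.
have n0 : (0 < n)%N by apply: leq_trans (ltn_ord a).
rewrite !modnMDl !modn_small // !divnMDl // !divn_small // !addn0.
by move=> /val_inj -> /val_inj ->.
Qed.

Definition csign A x : int := (-1) ^+ before A x.

Definition simplicial_incidence F G : int :=
  \sum_(A | good_cell A && (cell A == F))
    \sum_(x | [&& x \in A, full (A :\ x) & cell (A :\ x) == G]) csign A x.

Lemma sincE A G : good_cell A -> simplicial_incidence (cell A) G =
  \sum_(x | [&& x \in A, full (A :\ x) & cell (A :\ x) == G]) csign A x.
Proof.
move=> gA; rewrite /simplicial_incidence (big_pred1 A) // => B.
apply/andP/eqP => [[gB /eqP]|->]; last by [].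
exact: good_cell_inj.
Qed.

Lemma before_remove A x y : x \in A -> x != y ->
  before A y = (before (A :\ x) y + (pair_key x < pair_key y))%N.
Proof.
move=> xA xy; rewrite /before.
rewrite (cardsD1 x) inE xA /= addnC; congr (_ + _)%N.
by apply: eq_card => z; rewrite !inE andbA.
Qed.

Lemma csign_swap A x y : x \in A -> y \in A -> x != y ->
  csign A x * csign (A :\ x) y = - (csign A y * csign (A :\ y) x).
Proof.
move=> xA yA xy; rewrite /csign (before_remove yA) 1?eq_sym //.
rewrite (before_remove xA xy) !exprD -!mulrA.
have rxy : pair_key x != pair_key y.
  by apply: contraNneq xy => /pair_key_inj ->.
case: (ltngtP (pair_key x) (pair_key y)) rxy => // _ _; rewrite ?expr1 ?expr0; ring.
Qed.

(** An edge is the case where a single A_p has two elements: they are consecutive in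
    the lexicographic order, so the signs at its endpoints are opposite. *)
Lemma csign_pair A p (a b : 'I_n) : (p, a) \in A -> (p, b) \in A -> (a < b)%N ->
  (forall e, (p, e) \in A -> e = a \/ e = b) ->
  csign A (p, a) + csign A (p, b) = 0.
Proof.
move=> pa pb ab only; rewrite /csign.
suff -> : before A (p, b) = (before A (p, a)).+1 by rewrite exprS mulN1r subrr.
rewrite /before (cardsD1 (p, a)) inE pa /pair_key /= ltn_add2l ab add1n; congr _.+1.
apply: eq_card => -[q e]; rewrite !inE xpair_eqE /=.
have [qe|//] := boolP ((q, e) \in A); rewrite ?andbF //=.
have [qp|qp] := eqVneq q p; rewrite /=.
  rewrite qp in qe *; rewrite !ltn_add2l; have [->|->] := only _ qe.
    by rewrite eqxx ltnn.
  by rewrite ltnn andbF ltnNge ltnW.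
move: (ltn_ord a) (ltn_ord b) (ltn_ord e).
have : q != p :> nat by [].
move: (nat_of_ord q) (nat_of_ord p) (nat_of_ord a) (nat_of_ord b) (nat_of_ord e).
by move=> q' p' a' b' e' qp' *; case: (ltngtP q' p') qp' => // qp' _; nia.
Qed.

Lemma sum_antisym (I : finType) (f : I -> I -> int) (Q : I -> I -> bool) :
  (forall x y, Q x y = Q y x) -> (forall x y, Q x y -> f x y = - f y x) ->
  \sum_x \sum_(y | Q x y) f x y = 0.
Proof.
move=> Qs fs; set T := \sum_x _.
have : T = - T.
  rewrite {1}/T; under eq_bigr => x _ do rewrite big_mkcond.
  rewrite exchange_big /= -sumrN; apply: eq_bigr => y _.
  rewrite -big_mkcond -sumrN; apply: eq_big => x; first by rewrite Qs.
  by move=> /fs ->.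
by lia.
Qed.

Lemma incidence_exists : exists eps, incidence R X eps.
Proof.
exists simplicial_incidence.
have good_rem A x : good_cell A -> full (A :\ x) -> good_cell (A :\ x).
  by move=> gA; apply: good_cell_sub gA (subsetDl _ _).
have rem_inj A x y : x \in A -> y \in A -> A :\ x = A :\ y -> x = y.
  move=> xA yA /setP /(_ y); rewrite !inE yA eqxx !andbT.
  by move=> /negbFE/eqP ->.
have sinc0 G : simplicial_incidence set0 G = 0.
  rewrite /simplicial_incidence big1 // => A /andP [gA /eqP A0].
  by have := cell0 (good_cell_full gA); rewrite A0 eqxx.
have signE A x : csign A x = 1 \/ csign A x = -1.
  by rewrite /csign -signr_odd; case: odd; [right|left].
split.
- move=> F G /XP [->|[A gA ->]]; first by case=> _ _; rewrite /pdim big_set0 mxrank0.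
  move=> /(facet_good_cell _ gA) [x [xA fx ->]].
  rewrite sincE // (big_pred1 x) // => y; apply/and3P/eqP => [[yA fy /eqP e]|->]; last by [].
  by apply: (rem_inj A) => //; apply: good_cell_inj e; exact: good_rem.
- move=> F G /XP [->|[A gA ->]] nfac; first exact: sinc0.
  rewrite sincE // big1 // => x /and3P [xA fx /eqP e]; case: nfac.
  by apply/(facet_good_cell _ gA); exists x.
- move=> F /XP [->|[A gA ->]]; first by rewrite /pdim big_set0 mxrank0.
  rewrite pdim_good_cell // => cA.
  under eq_bigr => G _ do rewrite sincE //.
  rewrite (exchange_big_dep (fun x => (x \in A) && full (A :\ x))) /=; last first.
    by move=> G x _ /and3P [-> ->].
  have -> : \sum_(x | (x \in A) && full (A :\ x))
     \sum_(G | [&& x \in A, full (A :\ x) & cell (A :\ x) == G]) csign A x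
     = \sum_(x in A | full (A :\ x)) csign A x.
    apply: eq_bigr => x /andP [-> ->] /=; rewrite (big_pred1 (cell (A :\ x))) //.
  have fA := good_cell_full gA.
  have cA1 : #|A| = d.+1 by move: cA (full_card fA); lia.
  (* An edge has d + 1 pairs, so exactly one component has two elements, a and c p. *)
  have [c cA'] := full_select0 fA; have := cA'; rewrite selects_graph => gcA.
  have : #|A :\: graph c| = 1%N by rewrite cardsD (setIidPr gcA) card_graph cA1 subSnn.
  move=> /eqP /cards1P [[p a] pE].
  have /setDP [pA ca] : (p, a) \in A :\: graph c by rewrite pE set11.
  rewrite in_graph in ca.
  have AE q e : (q, e) \in A -> e = c q \/ (q = p /\ e = a).
    move=> qA; have [->|ce] := eqVneq e (c q); first by left.
    have : (q, e) \in A :\: graph c by rewrite in_setD qA in_graph eq_sym ce.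
    by rewrite pE inE => /eqP [-> ->]; right.
  have fullE x : (x \in A) && full (A :\ x) = (x == (p, a)) || (x == (p, c p)).
    apply/andP/orP => [[xA /fullP fx]|].
      case: x xA fx => q e xA fx; have [f] := fx q; rewrite !inE xpair_eqE eqxx /=.
      move=> /andP [fe /AE h]; case: (AE _ _ xA) => [eE|[-> ->]]; last by rewrite eqxx; left.
      case: h => [fE|[qp _]]; first by rewrite fE eE eqxx in fe.
      by right; rewrite eE qp.
    move=> [] /eqP -> ; split=> //; try exact: (selectsP _ _ cA'); apply/fullP => q.
      exists (c q); rewrite !inE (selectsP _ _ cA') andbT xpair_eqE.
      by case: (q =P p) => [->|].
    have [->|qp] := eqVneq q p; first by exists a; rewrite !inE pA xpair_eqE eqxx /= eq_sym ca.
    by exists (c q); rewrite !inE (selectsP _ _ cA') andbT xpair_eqE (negPf qp).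
  rewrite (eq_bigl _ _ fullE) (bigD1 (p, a)) ?eqxx //= (big_pred1 (p, c p)) => [|x]; last first.
    by rewrite /= andbC; case: (x =P (p, a)) => [->|] //=;
      rewrite xpair_eqE eqxx eq_sym (negPf ca).
  have only e : (p, e) \in A -> e = a \/ e = c p by move=> /AE [|[]]; auto.
  have cp := selectsP _ _ cA' p.
  case: (ltngtP a (c p)) => [lt|lt|/val_inj e]; last by rewrite e eqxx in ca.
    exact: csign_pair.
  by rewrite addrC; apply: csign_pair => // e /only [] ->; auto.
move=> F H /XP [->|[A gA ->]].
  by apply: big1 => G _; rewrite sinc0 mul0r.
under eq_bigr => G _ do rewrite sincE // mulr_suml.
rewrite (exchange_big_dep (fun x => (x \in A) && full (A :\ x))) /=; last first.
  by move=> G x _ /and3P [-> ->].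
have -> : \sum_(x | (x \in A) && full (A :\ x))
     \sum_(G | [&& x \in A, full (A :\ x) & cell (A :\ x) == G])
        csign A x * simplicial_incidence G H
   = \sum_(x in A | full (A :\ x)) csign A x * simplicial_incidence (cell (A :\ x)) H.
  apply: eq_bigr => x /andP [-> ->] /=; rewrite (big_pred1 (cell (A :\ x))) //.
pose Q x y := [&& x \in A, y \in A, x != y, full (A :\ x :\ y) & cell (A :\ x :\ y) == H].
have swap x y : A :\ x :\ y = A :\ y :\ x by rewrite !setDDl setUC.
have fx x y : full (A :\ x :\ y) -> full (A :\ x).
  move=> /fullP f; apply/fullP => p; have [e] := f p.
  by rewrite in_setD => /andP [_ h]; exists e.
transitivity (\sum_x \sum_(y | Q x y) csign A x * csign (A :\ x) y).
  rewrite big_mkcond; apply: eq_bigr => x _; case: ifP => [/andP [xA fxA]|nx].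
    rewrite sincE ?good_rem // mulr_sumr; apply: eq_bigl => y.
    by rewrite /Q xA /= !inE eq_sym andbC; case: (y \in A); case: (_ != _);
      rewrite /= ?andbF ?andbT.
  rewrite big_pred0 // => y; apply/negbTE; apply: contraFN nx.
  by move=> /and5P [-> _ _ /fx ->].
apply: sum_antisym => x y.
  by rewrite /Q swap eq_sym; case: (x \in A); case: (y \in A).
by move=> /and5P [xA yA xy _ _]; exact: csign_swap.
Qed.

End Complex.

(** * Acyclicity from a matching *)

Section Matching.
Variables (K : fieldType) (T : finType) (e : T -> T -> K) (C : pred T).
Variables (M : T -> T) (up : pred T) (r : T -> nat).
Local Open Scope ring_scope.

Hypothesis CM : forall F, C F -> C (M F).
Hypothesis MK : forall F, C F -> M (M F) = F.
Hypothesis upM : forall F, C F -> up (M F) = ~~ up F.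
Hypothesis e_pair : forall F, C F -> ~~ up F -> e (M F) F != 0.
Hypothesis e_rank : forall F G, C F -> up F -> C G -> ~~ up G -> e F G != 0 ->
  G != M F -> (r G < r (M F))%N.
Hypothesis e_closed : forall F G, C F -> e F G != 0 -> C G.
Hypothesis ee0 : forall F H, C F -> \sum_G e F G * e G H = 0.

Definition bdry (c : T -> K) (G : T) : K := \sum_F e F G * c F.

Lemma bdry_closed c : (forall F, c F != 0 -> C F) -> forall G, bdry c G != 0 -> C G.
Proof.
move=> cC G; apply: contraNT => nG; apply/eqP/big1 => F _.
have [->|cF] := eqVneq (c F) 0; first by rewrite mulr0.
have [->|eF] := eqVneq (e F G) 0; first by rewrite mul0r.
by rewrite (e_closed (cC _ cF) eF) in nG.
Qed.

Lemma bdryB c b G : bdry (fun F => c F - b F) G = bdry c G - bdry b G.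
Proof. by rewrite /bdry -sumrB; apply: eq_bigr => F _; rewrite mulrBr. Qed.

Lemma bdryK c G : (forall F, c F != 0 -> C F) -> bdry (bdry c) G = 0.
Proof.
move=> cC; rewrite /bdry; under eq_bigr => F _ do rewrite mulr_sumr.
rewrite exchange_big /=; apply: big1 => F _.
have [->|cF] := eqVneq (c F) 0; first by apply: big1 => F' _; rewrite !mulr0.
transitivity ((\sum_F' e F F' * e F' G) * c F); last by rewrite ee0 ?mul0r ?cC.
by rewrite mulr_suml; apply: eq_bigr => F' _; rewrite mulrA [e F' G * _]mulrC.
Qed.

(** Lower cells are eliminated by decreasing rank: subtracting a multiple of the
    boundary of the mate of a lower cell of maximal rank only affects, among lower
    cells, that cell and cells of smaller rank. *)
Lemma clear_lower N c : (forall F, c F != 0 -> C F) ->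
  (forall G, c G != 0 -> ~~ up G -> (r G < N)%N) ->
  exists2 b, forall F, b F != 0 -> C F &
    forall G, c G - bdry b G != 0 -> up G.
Proof.
elim: N c => [|N IHN] c cC cN.
  exists (fun=> 0) => [F|G]; first by rewrite eqxx.
  rewrite /bdry big1 ?subr0 => [cG|F _]; last by rewrite mulr0.
  by apply: contraT => /(cN _ cG).
(* The mates of the lower cells of rank N, scaled so as to cancel these cells. *)
pose b0 F := if [&& C F, up F & r (M F) == N] then c (M F) / e F (M F) else 0.
have b0C F : b0 F != 0 -> C F by rewrite /b0; case: and3P => [[]|]; rewrite ?eqxx.
have [F|G|b bC bup] := IHN (fun F => c F - bdry b0 F).
- have [/cC //|/negPf] := boolP (c F != 0); rewrite ?negbK => /eqP ->.
  by rewrite sub0r oppr_eq0; exact: bdry_closed.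
- move=> nz lG; rewrite ltnNge; apply: contra nz => NG.
  have [CG|nCG] := boolP (C G); last first.
    have /eqP -> : c G == 0 by apply: contraNT nCG; exact: cC.
    have /eqP -> : bdry b0 G == 0 by apply: contraNT nCG; exact: bdry_closed.
    by rewrite subr0.
  rewrite /bdry (bigD1 (M G)) //= big1 ?addr0 => [|F FMG]; last first.
    rewrite /b0; case: and3P => [[CF uF /eqP rF]|_]; last by rewrite mulr0.
    have [->|eF] := eqVneq (e F G) 0; first by rewrite mul0r.
    have GMF : G != M F by apply: contraNneq FMG => ->; rewrite MK.
    by have := e_rank CF uF CG lG eF GMF; rewrite rF ltnNge NG.
  rewrite /b0 CM // upM // lG MK //=; case: (r G =P N) => [_|rN].
    by rewrite mulrC divfK ?e_pair ?subrr.
  rewrite mulr0 subr0; apply: contraT => /cN /(_ lG); rewrite ltnS leq_eqVlt.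
  by move: NG rN; case: ltngtP => // ->.
exists (fun F => b0 F + b F) => [F|G].
  have [->|/b0C //] := eqVneq (b0 F) 0; rewrite add0r; exact: bC.
have -> : bdry (fun F => b0 F + b F) G = bdry b0 G + bdry b G.
  by rewrite /bdry -big_split /=; apply: eq_bigr => F _; rewrite mulrDr.
by rewrite opprD addrA; exact: bup.
Qed.

(** At the mate of an upper cell of maximal rank, no other cell contributes to the
    boundary. *)
Lemma upper_cycle c : (forall F, c F != 0 -> C F /\ up F) ->
  (forall G, bdry c G = 0) -> forall F, c F = 0.
Proof.
move=> cC cyc F0; apply/eqP; apply: contraT => cF0.
case: (arg_maxnP (P := fun F => c F != 0) (fun F => r (M F)) cF0) => F cF maxF.
have [CF uF] := cC _ cF.
have := cyc (M F); rewrite /bdry (bigD1 F) //= big1 ?addr0 => [|F' FF'].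
  move/eqP; rewrite mulf_eq0 (negPf cF) orbF => eF.
  by have := e_pair (CM CF); rewrite upM // uF MK // eF => /(_ isT).
have [->|cF'] := eqVneq (c F') 0; first by rewrite mulr0.
have [->|eF] := eqVneq (e F' (M F)) 0; first by rewrite mul0r.
have [CF' uF'] := cC _ cF'.
have lMF : ~~ up (M F) by rewrite upM // uF.
have ne : M F != M F'.
  by apply: contraNneq FF' => h; rewrite -(MK CF) h MK.
have := e_rank CF' uF' (CM CF) lMF eF ne; rewrite ltnNge.
by have := maxF _ cF'; rewrite /= => ->.
Qed.

(** A matching by invertible incidences, with a rank decreasing along alternating
    paths, kills the homology. Only the nonvanishing of the matched incidences matters,
    so the argument applies to any incidence function. *)
Lemma matching_acyclic c : (forall F, c F != 0 -> C F) ->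
  (forall G, bdry c G = 0) ->
  exists2 b, forall F, b F != 0 -> C F & forall G, bdry b G = c G.
Proof.
move=> cC cyc.
have [F cF _|b bC bup] := @clear_lower (\max_F r F).+1 c cC.
  by rewrite ltnS; exact: leq_bigmax.
exists b => // G; apply/eqP; rewrite eq_sym -subr_eq0; apply/eqP.
apply: (@upper_cycle (fun G => c G - bdry b G)) => [F nz|G'].
  split; last exact: bup.
  have [/cC //|/negPf] := boolP (c F != 0); rewrite ?negbK => /eqP c0.
  by move: nz; rewrite c0 sub0r oppr_eq0; exact: bdry_closed.
by rewrite bdryB cyc bdryK // subrr.
Qed.

End Matching.

(** * The matching on the cells below a monomial *)

Section CellMatching.
Variables (n d : nat) (s : 'I_d -> 'I_n).
Hypothesis s_mono : forall p q : 'I_d, p <= q -> s p <= s q.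
Hypothesis d_gt0 : 0 < d.
Variable mu : 'X_{1..n}.

Local Notation choice := {ffun 'I_d -> 'I_n}.
Local Notation pairs := ('I_d * 'I_n)%type.
Implicit Types (A B : {set 'I_d * 'I_n}) (c : choice).

Definition good_below w c := good s (s w) (graph c) && (mon c <= mu)%MM.

(** The vertex that dominates all vertices dividing [mu], coordinatewise for levels.
    It lies in every window in which some vertex divides [mu]. *)
Definition top_choice g := forall w c, good_below w c ->
  good_below w g /\ forall p, level s (p, c p) <= level s (p, g p).

(** A good choice with the largest sum of levels: its maximum with any other good choice
    is again good and below [mu], so is itself. *)
Lemma top_choice_exists w c : good_below w c ->
  exists w' g, good_below w' g /\ top_choice g.
Proof.
move=> wc.
pose P (x : 'I_d * choice) := good_below x.1 x.2.
pose f (x : 'I_d * choice) := \sum_p level s (p, x.2 p).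
case: (@arg_maxnP _ (w, c) P f wc) => -[w0 g] /= gg gmax.
exists w0, g; split=> // v e /[dup] ve /andP [ge lee].
have /andP [gg1 gg2] := gg.
have [h [gh leh hE]] := good_choice_max s_mono ge gg1 lee gg2.
have hg p : level s (p, h p) = level s (p, g p).
  have : f (v, h) <= f (w0, g) by apply: gmax; rewrite /P /good_below gh leh.
  rewrite /f /= => le.
  have ge_ q : level s (q, g q) <= level s (q, h q) by rewrite hE leq_maxr.
  apply/eqP; rewrite eqn_leq ge_ andbT.
  move: le; rewrite (bigD1 p) //= [leqRHS](bigD1 p) //=.
  have : \sum_(i < d | i != p) level s (i, g i) <= \sum_(i < d | i != p) level s (i, h i).
    by apply: leq_sum => q _; exact: ge_.
  move: (level s (p, h p)) (level s (p, g p)) => x y.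
  move: (\sum_(i < d | _) level s (i, g i)) (\sum_(i < d | _) level s (i, h i)).
  by clear; lia.
have {hg} eh : h = g by apply/ffunP => p; exact: (level_inj (hg p)).
rewrite eh in gh hE leh; split; first by rewrite /good_below gh leh.
by move=> p; rewrite hE leq_maxl.
Qed.

Variable g : choice.
Hypothesis g_top : top_choice g.
Hypothesis g_good : exists w, good_below w g.

(** The cells whose label divides [mu]; [cells] adds the empty face, so that the empty
    face is matched with the top vertex. *)
Definition below A := good_cell s A && (colsums A <= mu)%MM.
Definition cells A := (A == set0) || below A.

(** A cell may lie in several windows. Its base is the first one, and the base
    of a facet is not later; this is what makes the rank of the matching decrease. *)
Definition first_window A : nat := find (fun w => A \subset window s (s w)) (enum 'I_d).
Definition base A : 'I_n := s (nth (Ordinal d_gt0) (enum 'I_d) (first_window A)).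
Definition off A p := [exists a, ((p, a) \in A) && (a != g p)].
(** The last factor, in the order of the base, at which the cell is not reduced to the
    component of the top vertex. *)
Definition pivot A : 'I_d := odflt (Ordinal d_gt0)
  [pick p | off A p && [forall q, off A q ==> (frank s (base A) q <= frank s (base A) p)]].
Definition pivot_elt A : pairs := (pivot A, g (pivot A)).
(** The matching adds or removes the top vertex in the component of the pivot. *)
Definition mate A : {set pairs} :=
  if A == set0 then graph g else if A == graph g then set0
  else if pivot_elt A \in A then A :\ pivot_elt A else pivot_elt A |: A.
Definition upper A : bool :=
  (A != set0) && ((A == graph g) || (pivot_elt A \in A)).
Definition mrank A : nat :=
  if A == set0 then 0 else first_window A * (d + d) + frank s (base A) (pivot A).

Lemma below_full A : below A -> full A.
Proof. by move=> /andP [/good_cell_full]. Qed.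

Lemma below_neq0 A : below A -> A != set0.
Proof.
move=> /below_full /full_card; apply: contraTneq => ->.
by rewrite cards0 -ltnNge.
Qed.

Lemma below_sub A B : below A -> B \subset A -> full B -> below B.
Proof.
move=> /andP [gA le] BA fB; apply/andP; split; first exact: good_cell_sub gA BA fB.
exact: lepm_trans (colsumsS BA) le.
Qed.

Lemma below_choice A w c : below A -> good s (s w) A -> selects c A -> good_below w c.
Proof.
move=> /andP [_ le] gA cA; apply/andP; split.
  by apply: good_sub gA _ (graph_full _) => //; rewrite -selects_graph.
exact: lepm_trans (mon_colsums cA) le.
Qed.

Lemma base_good A : below A -> good s (base A) A.
Proof.
move=> /andP [/existsP [w gA] _]; apply: (good_window gA).
apply: (@nth_find _ _ (fun w => A \subset window s (s w))); apply/hasP; exists w.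
  by rewrite mem_enum.
by case/and3P: gA.
Qed.

Lemma below_level A p a : below A -> (p, a) \in A -> level s (p, a) <= level s (p, g p).
Proof.
move=> bA pa; have [w gA] := existsP (andP bA).1.
have [c cA <-] := full_select (below_full bA) pa.
by have [_] := g_top (below_choice bA gA cA).
Qed.

Lemma below_graph A w : below A -> A \subset window s (s w) ->
  good s (s w) (graph g).
Proof.
move=> bA wA; have [w' gA'] := existsP (andP bA).1.
have gA := good_window gA' wA.
have [c cA] := full_select0 (below_full bA).
by have [/andP []] := g_top (below_choice bA gA cA).
Qed.

Lemma below_graph_base A : below A -> good s (base A) (graph g).
Proof. by move=> bA; apply: (below_graph bA); case/and3P: (base_good bA). Qed.

Lemma below_top : below (graph g).
Proof.
have [w /andP [gg le]] := g_good; apply/andP; split; first by apply/existsP; exists w.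
apply: lepm_trans le; apply/mnm_lepP => a; rewrite mnmE monE.
by apply/subset_leq_card/subsetP => p; rewrite !inE.
Qed.

Lemma below_vrank A p a : below A -> (p, a) \in A ->
  vrank (base A) a <= vrank (base A) (g p).
Proof.
move=> bA pa; have := below_level bA pa.
have /goodP - /(_ s_mono) [_ /subsetP wA _] := base_good bA.
have /goodP - /(_ s_mono) [_ /subsetP wg _] := below_graph_base bA.
rewrite (level_vrank (wA _ pa)) (level_vrank (wg (p, g p) _)) ?in_graph //=.
by case: ifP; rewrite ?leq_add2r.
Qed.

Lemma pivotP A : below A -> A != graph g -> off A (pivot A) /\
  forall q, off A q -> frank s (base A) q <= frank s (base A) (pivot A).
Proof.
move=> bA Ag.
have [p0 p0A] : exists p, off A p.
  apply/existsP; apply: contraT; rewrite negb_exists => /forallP h.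
  have sub : A \subset graph g.
    apply/subsetP => -[p a] pa; rewrite in_graph eq_sym.
    have := h p; rewrite negb_exists => /forallP /(_ a).
    by rewrite pa negbK.
  move: Ag; rewrite eqEsubset sub /= -selects_graph => /selectsP [] p.
  have [a pa] := fullP _ (below_full bA) p.
  by have := subsetP sub _ pa; rewrite in_graph => /eqP ->.
rewrite /pivot; case: pickP => [p /andP [pA /forallP h]|/= h].
  by split=> // q; apply/implyP: (h q).
case: (arg_maxnP (P := off A) (frank s (base A)) p0A) => p pA pmax.
have := h p; rewrite pA /=; move/negbT/forallPn => [q]; rewrite negb_imply => /andP [qA].
by have /= -> := pmax q qA.
Qed.

Lemma off_eq A B : (forall p a, a != g p -> ((p, a) \in A) = ((p, a) \in B)) ->
  off A =1 off B.
Proof.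
by move=> AB p; apply: eq_existsb => a; rewrite andbC [RHS]andbC; apply: andb_id2l => /AB.
Qed.

Lemma same_pivot A B :
  (forall p a, a != g p -> ((p, a) \in A) = ((p, a) \in B)) ->
  (forall w, (A \subset window s (s w)) = (B \subset window s (s w))) ->
  [/\ first_window A = first_window B, base A = base B & pivot A = pivot B].
Proof.
move=> AB wAB.
have fE : first_window A = first_window B by exact: eq_find.
have bE : base A = base B by rewrite /base fE.
split=> //; rewrite /pivot; congr odflt; apply: eq_pick => p.
rewrite (off_eq AB) bE; congr (_ && _); apply: eq_forallb => q.
by rewrite (off_eq AB).
Qed.

Lemma pivot_elt_window A w : below A -> A \subset window s (s w) ->
  pivot_elt A \in window s (s w).
Proof.
move=> bA /(below_graph bA) /and3P [_ _ /subsetP]; apply.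
by rewrite in_graph.
Qed.

(** At the pivot p the other elements of A_p are smaller than [g p] as [g] dominates,
    and after p the cell coincides with [g]. So [g p] fits between both, and the
    occurrences of that variable in the enlarged cell are occurrences in [g]. *)
Lemma mate_add A : below A -> A != graph g -> pivot_elt A \notin A ->
  below (pivot_elt A |: A) /\
  (forall w, (pivot_elt A |: A \subset window s (s w)) = (A \subset window s (s w))).
Proof.
move=> bA Ag xA; set x := pivot_elt A; set p := pivot A.
have win w : (x |: A \subset window s (s w)) = (A \subset window s (s w)).
  rewrite subUset sub1set; have [h|_] := boolP (A \subset _); last exact: andbF.
  by rewrite andbT; exact: pivot_elt_window.
split=> //.
have [/existsP [a /andP [pa ap]] pmax] := pivotP bA Ag.
have gA := base_good bA.
have [fA wA sA] := goodP s_mono _ _ gA.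
have [_ _ sg] := goodP s_mono _ _ (below_graph_base bA).
have lt_a : vrank (base A) a < vrank (base A) (g p).
  rewrite ltn_neqAle below_vrank // andbT.
  by apply: contra ap => /eqP/vrank_inj ->.
have not_off q b : ~~ off A q -> (q, b) \in A -> b = g q.
  rewrite negb_exists => /forallP /(_ b) + qb; rewrite qb negbK => /eqP //.
apply/andP; split.
  apply/existsP; exists (nth (Ordinal d_gt0) (enum 'I_d) (first_window A)).
  apply/(goodP s_mono); split.
  - by move=> q; have [b qb] := fA q; exists b; rewrite inE qb orbT.
  - by rewrite win.
  move=> [q b] [r e]; rewrite -/(base A) !in_setU1 => /orP [/eqP [-> ->]|qA] /orP [/eqP [->
    ->]|rA] /=.
  - by rewrite ltnn.
  - move=> lt; have nr : ~~ off A r by apply: contraL lt => /pmax; rewrite -leqNgt.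
    by rewrite (not_off _ _ nr rA); apply: (sg (p, g p) (r, g r)) => //; rewrite in_graph.
  - by move=> lt; apply: leq_trans (ltnW lt_a); exact: (sA (q, b) (p, a)).
  - exact: (sA (q, b) (r, e)).
apply/mnm_lepP => b; rewrite mnmE.
have [/eqP bg|bg] := boolP (b == g p); last first.
  have /andP [_ /mnm_lepP /(_ b)] := bA; rewrite mnmE; apply: leq_trans.
  apply/subset_leq_card/subsetP => q; rewrite !inE xpair_eqE.
  by rewrite [b == _](negPf bg) andbF.
have /andP [_ /mnm_lepP /(_ b)] := below_top; rewrite mnmE; apply: leq_trans.
apply/subset_leq_card/subsetP => q;
  rewrite !inE /= xpair_eqE => /orP [/andP [/eqP -> /eqP ->]|] //.
rewrite bg => qA; have [qo|nq] := boolP (off A q); last by rewrite (not_off _ _ nq qA).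
have [-> //|qp] := eqVneq q p.
have lt : frank s (base A) q < frank s (base A) p.
  by rewrite ltn_neqAle pmax // andbT; apply: contra qp => /eqP/frank_inj ->.
by have /= := sA (q, g p) (p, a) qA pa lt; rewrite leqNgt lt_a.
Qed.

Lemma mate_remove A : below A -> A != graph g -> pivot_elt A \in A ->
  below (A :\ pivot_elt A) /\
  (forall w, (A :\ pivot_elt A \subset window s (s w)) = (A \subset window s (s w))).
Proof.
move=> bA Ag xA; set x := pivot_elt A.
have [/existsP [a /andP [pa ap]] _] := pivotP bA Ag.
have fB : full (A :\ x).
  apply/fullP => q; have [b qb] := fullP _ (below_full bA) q.
  have [->|qp] := eqVneq q (pivot A).
    by exists a; rewrite !inE pa andbT xpair_eqE (negPf ap) andbF.
  by exists b; rewrite !inE qb andbT xpair_eqE (negPf qp).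
have bB : below (A :\ x).
  exact: below_sub bA (subsetDl _ _) fB.
split=> // w; apply/idP/idP => [wB|]; last by apply: subset_trans; exact: subsetDl.
apply/subsetP => y yA; have [->|yx] := eqVneq y x.
  have /and3P [_ _ /subsetP] := below_graph bB wB; apply.
  by rewrite in_graph.
by apply: (subsetP wB); rewrite !inE yx.
Qed.

(** Toggling changes neither the windows that contain the cell nor the components other
    than those of [g], hence neither the base nor the pivot: it is an involution. *)
Lemma mate_spec A : below A -> A != graph g ->
  [/\ (below (mate A) /\ mate A != graph g), pivot (mate A) = pivot A,
      (first_window (mate A) = first_window A /\ base (mate A) = base A),
      (pivot_elt A \in mate A) = (pivot_elt A \notin A)
    & mate (mate A) = A].
Proof.
move=> bA Ag; have A0 := below_neq0 bA.
have offA := (pivotP bA Ag).1.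
have mE : mate A = if pivot_elt A \in A then A :\ pivot_elt A else pivot_elt A |: A.
  by rewrite /mate (negPf A0) (negPf Ag).
have bw : below (mate A) /\
    forall w, (mate A \subset window s (s w)) = (A \subset window s (s w)).
  by rewrite mE; case: ifP => h; [exact: mate_remove | apply: mate_add; rewrite ?h].
have sameA p a : a != g p -> ((p, a) \in mate A) = ((p, a) \in A).
  move=> ag; rewrite mE; case: ifP => _; rewrite !inE xpair_eqE;
  by case: (p =P pivot A) => [pp|] //=; rewrite -pp (negPf ag).
have [bM wM] := bw; have [fE bE pE] := same_pivot sameA wM.
have Mg : mate A != graph g.
  apply: contraTneq offA => h; rewrite -(off_eq sameA) h; apply/existsPn => a.
  by rewrite in_graph eq_sym andbN.
have xE : pivot_elt (mate A) = pivot_elt A by rewrite /pivot_elt pE.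
have inM : (pivot_elt A \in mate A) = (pivot_elt A \notin A).
  by rewrite mE; case: ifP => h; rewrite !inE eqxx.
split=> //; rewrite {1}/mate (negPf (below_neq0 bM)) (negPf Mg) xE inM mE.
by case: (boolP (pivot_elt A \in A)) => h /=; [exact: setD1K | rewrite setU1K ?h].
Qed.

Lemma mate_set0 : mate set0 = graph g. Proof. by rewrite /mate eqxx. Qed.
Lemma mate_graph : mate (graph g) = set0.
Proof. by rewrite /mate (negPf (below_neq0 below_top)) eqxx. Qed.

Lemma cells_cases A : cells A ->
  [\/ A = set0, A = graph g | below A /\ A != graph g].
Proof.
move=> /orP [/eqP ->|bA]; first by constructor 1.
by have [->|h] := eqVneq A (graph g); [constructor 2 | constructor 3].
Qed.

Lemma cells_mate A : cells A -> cells (mate A).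
Proof.
move=> /cells_cases [->|->|[bA Ag]]; rewrite /cells.
- by rewrite mate_set0 below_top orbT.
- by rewrite mate_graph eqxx.
- by have [[-> _] _ _ _ _] := mate_spec bA Ag; rewrite orbT.
Qed.

Lemma mateK A : cells A -> mate (mate A) = A.
Proof.
move=> /cells_cases [->|->|[bA Ag]].
- by rewrite mate_set0 mate_graph.
- by rewrite mate_graph mate_set0.
- by have [_ _ _ _ ->] := mate_spec bA Ag.
Qed.

Lemma upper_mate A : cells A -> upper (mate A) = ~~ upper A.
Proof.
move=> /cells_cases [->|->|[bA Ag]].
- by rewrite mate_set0 /upper !eqxx below_neq0 // below_top.
- by rewrite mate_graph /upper !eqxx below_neq0 // below_top.
have [[bM Mg] pE _ inM _] := mate_spec bA Ag.
rewrite /upper (negPf Mg) (negPf Ag) !below_neq0 //= -inM.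
by rewrite /pivot_elt pE.
Qed.

Lemma mate_facet A : below A -> A != graph g -> ~~ upper A ->
  [/\ pivot_elt A \in mate A, A = mate A :\ pivot_elt A & below (mate A)].
Proof.
move=> bA Ag uA; have [[bM Mg] pE _ inM _] := mate_spec bA Ag.
have xA : pivot_elt A \notin A.
  by apply: contra uA => h; rewrite /upper below_neq0 // h orbT.
split; rewrite ?inM //; rewrite /mate (negPf (below_neq0 bA)) (negPf Ag) (negPf xA).
by rewrite setU1K.
Qed.

(** A facet lies in at least the windows of the cell, so its base does not come later. If
    the base is the same, its pivot is not later either; and a lower facet has the same
    pivot only if the top element was removed there, that is if it is the mate. *)
Lemma mrank_lt A B : cells A -> upper A -> cells B -> ~~ upper B ->
  (exists2 x, x \in A & B = A :\ x) \/ (B = set0 /\ #|A| = d) ->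
  B != mate A -> mrank B < mrank (mate A).
Proof.
move=> /cells_cases [->|->|[bA Ag]] uA cB uB AB BM.
- by rewrite /upper eqxx in uA.
- case: AB => [[x xg BE]|[B0 _]]; last by rewrite mate_graph B0 eqxx in BM.
  have B0 : B != set0 by rewrite -mate_graph.
  move: cB; rewrite /cells (negPf B0) /= => /below_full/full_card.
  by have := cardsD1 x (graph g); rewrite card_graph xg -BE; lia.
have [[bM Mg] pE [fE bE] inM MK] := mate_spec bA Ag.
have xA : pivot_elt A \in A.
  by move: uA; rewrite /upper (negPf Ag) below_neq0.
have mE : mate A = A :\ pivot_elt A.
  by rewrite /mate (negPf (below_neq0 bA)) (negPf Ag) xA.
have cardM : #|A| = #|mate A|.+1 by rewrite (cardsD1 (pivot_elt A) A) xA mE.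
have dM := full_card (below_full bM).
case: AB => [[x xA' BE]|[_ cA]]; last by move: dM; rewrite leqNgt -ltnS -cardM cA ltnSn.
rewrite {2}/mrank (negPf (below_neq0 bM)) fE bE pE /mrank.
case: eqP => [B0|/eqP B0].
  move: cardM dM; rewrite (cardsD1 x A) xA' -BE B0 cards0 => -[<-].
  by rewrite leqNgt d_gt0.
have bB : below B by move: cB; rewrite /cells (negPf B0).
have Bg : B != graph g by apply: contra uB => h; rewrite /upper B0 h.
have xB : pivot_elt B \notin B.
  by apply: contra uB => h; rewrite /upper B0 h orbT.
have BA : B \subset A by rewrite BE subsetDl.
have le : first_window B <= first_window A.
  by apply: sub_find => w; apply: subset_trans BA.
have lt2d := frank_lt s (base B) (pivot B).
case: (ltngtP (first_window B) (first_window A)) le => // [lt|eqf] _.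
  apply: (@leq_trans ((first_window B).+1 * (d + d))); first by rewrite mulSn addnC ltn_add2r.
  by apply: leq_trans (leq_addr _ _); rewrite leq_mul2r lt orbT.
rewrite eqf ltn_add2l; have bBA : base B = base A by rewrite /base eqf.
have [offB _] := pivotP bB Bg; have [_ pmax] := pivotP bA Ag.
have : off A (pivot B).
  by have /existsP [a /andP [pa ag]] := offB; apply/existsP; exists a; rewrite (subsetP BA).
rewrite bBA => /pmax; rewrite leq_eqVlt => /orP [/eqP/frank_inj pp|//].
have xx : pivot_elt B = pivot_elt A by rewrite /pivot_elt pp.
case/negP: BM; rewrite mE BE; move: xB; rewrite xx BE !inE xA andbT negbK => /eqP ->.
exact: eqxx.
Qed.

End CellMatching.

(** * Acyclicity below a monomial *)

Section ScalarAcyclicity.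
Variables (R : realFieldType) (k : fieldType) (n d : nat) (s : 'I_d -> 'I_n).
Hypothesis s_mono : forall p q : 'I_d, p <= q -> s p <= s q.
Hypothesis d_gt0 : 0 < d.
Local Open Scope ring_scope.

Local Notation vset := {set 'X_{1..n < d.+1}}.
Local Notation pairs := ('I_d * 'I_n)%type.
Implicit Types (A B : {set 'I_d * 'I_n}) (F G H : vset).

Variable X : vset -> Prop.
Hypothesis XP : forall F, X F <-> F = set0 \/ exists2 A, good_cell s A & F = cell A.
Variable eps : vset -> vset -> int.
Hypothesis eps_inc : incidence R X eps.

Lemma unit_int (z : int) : z = 1 \/ z = -1 -> z%:~R != 0 :> k.
Proof. by case=> ->; rewrite ?mulrN1z ?oppr_eq0 oner_eq0. Qed.

Lemma eps_facet A G : good_cell s A -> eps (cell A) G != 0 ->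
  exists x, [/\ x \in A, full (A :\ x) & G = cell (A :\ x)].
Proof.
move=> gA nz; case: eps_inc => [_ e0 _ _].
have [/existsP [x /and3P [xA fx /eqP ->]]|nex] :=
  boolP [exists x, [&& x \in A, full (A :\ x) & G == cell (A :\ x)]].
  by exists x.
have XA : X (cell A) by apply: X_cell gA.
case/eqP: nz; apply: e0 => // /(facet_good_cell R s_mono _ gA) [x [xA fx GE]].
by case/negP: nex; apply/existsP; exists x; rewrite xA fx GE eqxx.
Qed.

Lemma eps_unit A x : good_cell s A -> x \in A -> full (A :\ x) ->
  (eps (cell A) (cell (A :\ x)))%:~R != 0 :> k.
Proof.
move=> gA xA fx; apply: unit_int; case: eps_inc => [e1 _ _ _]; apply: e1.
  exact: X_cell gA.
by apply/(facet_good_cell R s_mono _ gA); exists x.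
Qed.

Lemma eps_good A G : good_cell s A -> eps (cell A) G != 0 ->
  exists B, [/\ good_cell s B, B \subset A, #|A| = #|B|.+1 & G = cell B].
Proof.
move=> gA /(eps_facet gA) [x [xA fx ->]]; exists (A :\ x); split=> //.
- exact: good_cell_sub gA (subsetDl _ _) fx.
- exact: subsetDl.
- by rewrite (cardsD1 x A) xA.
Qed.

Lemma intr_neq0 (z : int) : z%:~R != 0 :> k -> z != 0.
Proof. by apply: contraNneq => ->. Qed.

Lemma sum_good_cells (V : nmodType) (f : vset -> V) :
  (forall G, f G != 0 -> exists2 B, good_cell s B & G = cell B) ->
  \sum_G f G = \sum_(B | good_cell s B) f (cell B).
Proof.
move=> fX; rewrite (bigID (mem [set cell B | B in good_cell s])) /=.
rewrite [X in _ + X]big1 ?addr0 => [|G]; last first.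
  apply: contraNeq => /fX [B gB ->]; exact: imset_f.
by rewrite big_imset //= => A B gA gB; exact: (good_cell_inj s_mono gA gB).
Qed.

(** The incidence function transported to labelled cells, and augmented: the empty cell
    is a facet of each vertex, with coefficient one. *)
Definition aug_eps A B : k :=
  if A == set0 then 0 else if B == set0 then (#|A| == d)%:R
  else if good_cell s B then (eps (cell A) (cell B))%:~R else 0.

Variable mu : 'X_{1..n}.

Lemma good_cell_neq0 A : good_cell s A -> A != set0.
Proof.
move=> /good_cell_full/full_card; apply: contraTneq => ->.
by rewrite cards0 -ltnNge.
Qed.

Lemma aug_eps_facet A B : cells s mu A -> aug_eps A B != 0 ->
  (exists2 x, x \in A & B = A :\ x /\ below s mu B) \/ (B = set0 /\ #|A| = d).
Proof.
move=> /orP [/eqP ->|bA]; first by rewrite /aug_eps !eqxx.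
have /andP [gA _] := bA; rewrite /aug_eps (negPf (good_cell_neq0 gA)).
have [-> h|_] := eqVneq B set0.
  by right; split=> //; apply/eqP; apply: contraNT h => /negPf ->; rewrite eqxx.
case: ifP => gB; last by rewrite eqxx.
move=> /intr_neq0 /(eps_facet gA) [x [xA fx e]]; left; exists x => //.
have BE : B = A :\ x.
  by apply: (good_cell_inj s_mono gB _ e); exact: good_cell_sub gA (subsetDl _ _) fx.
by rewrite BE; split=> //; exact: below_sub bA (subsetDl _ _) fx.
Qed.

Lemma aug_eps_closed A B : cells s mu A -> aug_eps A B != 0 -> cells s mu B.
Proof.
move=> cA /(aug_eps_facet cA) [[x _ [_ bB]]|[-> _]]; rewrite /cells ?eqxx //.
by rewrite bB orbT.
Qed.

Lemma eps_card A B : good_cell s A -> good_cell s B -> eps (cell A) (cell B) != 0 ->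
  #|A| = #|B|.+1.
Proof.
move=> gA gB /(eps_good gA) [B' [gB' _ cE e]].
by rewrite (good_cell_inj s_mono gB gB' e).
Qed.

(** For an edge and the empty cell this is the condition on incidence functions that the
    coefficients of the two endpoints add up to zero. *)
Lemma aug_eps_eps A : cells s mu A -> forall H : {set pairs}, \sum_B aug_eps A B * aug_eps
  B H = 0.
Proof.
move=> /orP [/eqP ->|bA] H.
  by apply: big1 => B _; rewrite /aug_eps eqxx mul0r.
have /andP [gA _] := bA; have A0 := good_cell_neq0 gA.
have cAA : cells s mu A by rewrite /cells bA orbT.
have [e1 e0 edge ee] := eps_inc; have XA := X_cell XP gA.
have [->|H0] := eqVneq H set0.
  have [cA|cA] := eqVneq #|A| d.+1; last first.
    apply: big1 => B _; have [->|/(aug_eps_facet cAA)] := eqVneq (aug_eps A B) 0.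
      by rewrite mul0r.
    case=> [[x xA [BE bB]]|[-> _]]; last by rewrite {2}/aug_eps eqxx mulr0.
    rewrite {2}/aug_eps eqxx; case: ifP => _; rewrite ?mulr0 //.
    case: eqP => [cB|]; rewrite ?mulr0 //.
    by move: cA; rewrite (cardsD1 x A) xA -BE cB add1n eqxx.
  transitivity (\sum_(B | good_cell s B) (eps (cell A) (cell B))%:~R : k).
    rewrite [RHS]big_mkcond; apply: eq_bigr => B _; rewrite /aug_eps eqxx (negPf A0).
    case: eqP => [->|/eqP B0]; first by rewrite mulr0; case: ifP => // /good_cell_neq0;
      rewrite eqxx.
    case: ifP => gB; last by rewrite mul0r.
    have [->|nz] := eqVneq (eps (cell A) (cell B)) 0; first by rewrite mul0r.
    by have := eps_card gA gB nz; rewrite cA => -[<-]; rewrite eqxx mulr1.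
  rewrite -(rmorph_sum (intr : int -> k)) /= -(sum_good_cells (f := eps (cell A))); last first.
    by move=> G /(eps_good gA) [B [gB _ _ ->]]; exists B.
  by rewrite edge // (pdim_good_cell R s_mono gA) cA subSnn.
have [gH|gH] := boolP (good_cell s H); last first.
  apply: big1 => B _; rewrite {2}/aug_eps (negPf H0) (negPf gH).
  by case: ifP; rewrite mulr0.
transitivity (\sum_(B | good_cell s B) (eps (cell A) (cell B) * eps (cell B) (cell H))%:~R : k).
  rewrite [RHS]big_mkcond; apply: eq_bigr => B _; rewrite /aug_eps (negPf A0) (negPf H0) gH.
  case: eqP => [->|/eqP B0]; first by rewrite mulr0; case: ifP => // /good_cell_neq0;
    rewrite eqxx.
  by case: ifP => gB; rewrite ?mul0r // intrM.
rewrite -(rmorph_sum (intr : int -> k)) /=.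
rewrite -(sum_good_cells (f := fun G => eps (cell A) G * eps G (cell H))); last first.
  move=> G h; have /(eps_good gA) [B [gB _ _ ->]] : eps (cell A) G != 0.
    by apply: contraNneq h => ->; rewrite mul0r.
  by exists B.
by rewrite ee.
Qed.

(** Scalar chains of dimension [i] on the cells whose label divides [mu]. *)
Definition degree_below i (f : vset -> k) : Prop :=
  forall F, f F != 0 -> exists A, [/\ below s mu A, #|A| = (d + i)%N & F = cell A].

Definition scalar_cycle i (f : vset -> k) : Prop :=
  if i is 0 then \sum_F f F = 0 else forall G, \sum_F (eps F G)%:~R * f F = 0.

Lemma scalar_acyclic i (f : vset -> k) : degree_below i f -> scalar_cycle i f ->
  exists2 b, degree_below i.+1 b & forall G, \sum_F (eps F G)%:~R * b F = f G.
Proof.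
move=> fdeg fcyc.
have [/existsP [F0 fF0]|nf] := boolP [exists F, f F != 0]; last first.
  exists (fun=> 0) => [F|G]; first by rewrite eqxx.
  rewrite big1 => [|F _]; last by rewrite mulr0.
  by move/existsPn/(_ G): nf; rewrite negbK => /eqP.
have [A0 [bA0 _ _]] := fdeg _ fF0.
have [w gA0] := existsP (andP bA0).1.
have [c0 c0A] := full_select0 (below_full bA0).
have [w' [g [g_good g_top]]] := top_choice_exists s_mono (below_choice s_mono bA0 gA0 c0A).
have g_good' : exists w, good_below s mu w g by exists w'.
pose c A := if good_cell s A then f (cell A) else 0.
have cC A : c A != 0 -> cells s mu A.
  rewrite /c; case: ifP => gA; last by rewrite eqxx.
  move=> /fdeg [B [bB _ e]]; have /andP [gB _] := bB.
  by rewrite (good_cell_inj s_mono gA gB e) /cells bB orbT.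
have ccard A : c A != 0 -> #|A| = (d + i)%N.
  rewrite /c; case: ifP => gA; last by rewrite eqxx.
  move=> /fdeg [B [/andP [gB _] cB e]].
  by rewrite (good_cell_inj s_mono gA gB e).
have fgood G : f G != 0 -> exists2 B, good_cell s B & G = cell B.
  by move=> /fdeg [B [/andP [gB _] _ ->]]; exists B.
have ccyc B : bdry aug_eps c B = 0.
  rewrite /bdry; have [->|B0] := eqVneq B set0.
    case: i fdeg fcyc ccard => [|i] fdeg fcyc ccard; last first.
      apply: big1 => A _; have [->|/ccard cA] := eqVneq (c A) 0; first by rewrite mulr0.
      rewrite /aug_eps eqxx; case: ifP => _; rewrite ?mul0r //.
      by rewrite cA -[X in _ == X]addn0 eqn_add2l mul0r.
    rewrite -[RHS]fcyc (sum_good_cells fgood) [RHS]big_mkcond.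
    apply: eq_bigr => A _; have [cA0|cA0] := eqVneq (c A) 0.
      by rewrite cA0 mulr0; move: cA0; rewrite /c; case: ifP => // _ ->.
    rewrite /aug_eps eqxx (ccard _ cA0) addn0 eqxx /c; have [gA|_] := boolP (good_cell s A).
      by rewrite (negPf (good_cell_neq0 gA)) mul1r.
    by rewrite mulr0.
  have [gB|gB] := boolP (good_cell s B); last first.
    apply: big1 => A _; rewrite /aug_eps (negPf B0) (negPf gB).
    by case: ifP; rewrite mul0r.
  transitivity (\sum_F (eps F (cell B))%:~R * f F).
    rewrite (sum_good_cells (f := fun F => (eps F (cell B))%:~R * f F)) => [|F h]; last first.
      by apply: fgood; apply: contraNneq h => ->; rewrite mulr0.
    rewrite [RHS]big_mkcond; apply: eq_bigr => A _; rewrite /aug_eps (negPf B0) gB /c.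
    case: ifP => [/eqP ->|_]; last by case: ifP; rewrite ?mulr0.
    by case: ifP => [/good_cell_neq0|]; rewrite ?eqxx ?mulr0.
  case: i fdeg fcyc ccard => [|i] fdeg fcyc ccard; last exact: fcyc.
  apply: big1 => F _; have [->|/fdeg [A [/andP [gA _] cA ->]]] := eqVneq (f F) 0.
    by rewrite mulr0.
  have [->|nz] := eqVneq (eps (cell A) (cell B)) 0; first by rewrite mul0r.
  have := full_card (good_cell_full gB).
  by rewrite leqNgt -ltnS -(eps_card gA gB nz) cA addn0 ltnSn.
have [] := @matching_acyclic k _ aug_eps (cells s mu) (mate s d_gt0 g) (upper s d_gt0 g)
  (mrank s d_gt0 g) _ _ _ _ _ _ _ c cC ccyc.
- move=> A; exact: cells_mate.
- move=> A; exact: mateK.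
- move=> A; exact: upper_mate.
- move=> A /(cells_cases g) [->|->|[bA Ag]] uA.
  + rewrite mate_set0 /aug_eps eqxx card_graph eqxx.
    by rewrite (negPf (below_neq0 d_gt0 (below_top g_good'))) oner_eq0.
  + by move: uA; rewrite /upper eqxx (below_neq0 d_gt0 (below_top g_good')).
  have [xM AE bM] := mate_facet s_mono g_top g_good' bA Ag uA.
  have /andP [gA _] := bA; have /andP [gM _] := bM.
  rewrite /aug_eps (negPf (good_cell_neq0 gM)) (negPf (good_cell_neq0 gA)) gA.
  by have := eps_unit gM xM; rewrite -AE; apply; exact: good_cell_full gA.
- move=> A B cA uA cB uB /(aug_eps_facet cA) h;
  apply: (mrank_lt s_mono g_top g_good' cA uA cB uB).
  by case: h => [[x xA [BE _]]|]; [left; exists x | right].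
- exact: aug_eps_closed.
- by move=> A H cA; exact: aug_eps_eps.
move=> b bC bE.
(* The other degrees of b do not contribute to the boundary in degree i. *)
pose beta F := \sum_(A | [&& good_cell s A, cell A == F & #|A| == (d + i.+1)%N]) b A.
have betaE A : good_cell s A -> beta (cell A) = if #|A| == (d + i.+1)%N then b A else 0.
  move=> gA; rewrite /beta; case: eqP => cA; last first.
    apply: big1 => B /and3P [gB /eqP e /eqP cB]; case: cA.
    by rewrite -(good_cell_inj s_mono gB gA e).
  rewrite (big_pred1 A) // => B; apply/and3P/eqP => [[gB /eqP e _]|->].
    exact: (good_cell_inj s_mono gB gA e).
  by rewrite gA eqxx cA.
have beta_deg : degree_below i.+1 beta.
  move=> F bF; have [A /and4P [gA /eqP AF /eqP cA bA]|h] := pickP (fun A =>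
    [&& good_cell s A, cell A == F, #|A| == (d + i.+1)%N & b A != 0]).
    exists A; split=> //; have := bC _ bA; rewrite /cells (negPf (good_cell_neq0 gA)) //.
  case/eqP: bF; apply: big1 => A /and3P [gA AF cA].
  by have := h A; rewrite gA AF cA /= => /negbFE/eqP.
exists beta => // G.
rewrite (sum_good_cells (f := fun F => (eps F G)%:~R * beta F)) => [|F h]; last first.
  have /beta_deg [A [/andP [gA _] _ ->]] : beta F != 0.
    by apply: contraNneq h => ->; rewrite mulr0.
  by exists A.
have [/existsP [B /and3P [gB /eqP GB /eqP cB]]|nG] :=
  boolP [exists B, [&& good_cell s B, G == cell B & #|B| == (d + i)%N]].
  have := bE B; rewrite /c gB -GB => <-.
  rewrite big_mkcond; apply: eq_bigr => A _; rewrite /aug_eps (negPf (good_cell_neq0 gB)) gB.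
  have [->|A0'] := eqVneq A set0.
    by rewrite mul0r; case: ifP => // /good_cell_neq0; rewrite eqxx.
  have [gA|gA] := boolP (good_cell s A); last first.
    have [->|/bC] := eqVneq (b A) 0; first by rewrite mulr0.
    by rewrite /cells (negPf A0') /= => /andP [gA']; rewrite gA' in gA.
  rewrite betaE // GB; have [->|nz] := eqVneq (eps (cell A) (cell B)) 0.
    by rewrite !mul0r.
  by rewrite (eps_card gA gB nz) cB addnS eqxx.
have -> : f G = 0.
  apply/eqP; apply: contraNT nG => /fdeg [B [/andP [gB _] cB ->]].
  by apply/existsP; exists B; rewrite gB cB !eqxx.
apply: big1 => A gA; rewrite betaE //; case: eqP => cA; last by rewrite mulr0.
have [->|/(eps_good gA) [B [gB _ cB GE]]] := eqVneq (eps (cell A) G) 0; first by rewrite mul0r.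
case/existsP: nG; exists B; rewrite gB GE eqxx /=.
by move: cB; rewrite cA addnS => -[->].
Qed.

End ScalarAcyclicity.

(** * Monomial ideals *)

Section Ideals.
Variables (n : nat) (k : fieldType).
Local Notation S := {mpoly k[n]}.
Local Open Scope ring_scope.

Lemma mcoeffMXE (p : S) u v :
  (p * 'X_[u])@_v = if (u <= v)%MM then p@_(v - u)%MM else 0.
Proof.
case: ifP => uv; first by rewrite -{1}(submK uv) addmC mcoeffMX.
rewrite {1}[p]mpolyE mulr_suml raddf_sum big1_seq // => w _.
rewrite /= -scalerAl -mpolyXD mcoeffZ mcoeffX; case: eqP => [e|]; rewrite ?mulr0 //.
by rewrite -e lem_addl in uv.
Qed.

Lemma ideal_gen0 (G : S -> Prop) : ideal_gen G 0.
Proof. by exists [::] => //; rewrite big_nil. Qed.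

Lemma ideal_genD (G : S -> Prop) p q : ideal_gen G p -> ideal_gen G q ->
  ideal_gen G (p + q).
Proof.
move=> [a aG ->] [b bG ->]; exists (a ++ b); last by rewrite big_cat.
by move=> x; rewrite mem_cat => /orP [/aG|/bG].
Qed.

Lemma ideal_genM (G : S -> Prop) a p : ideal_gen G p -> ideal_gen G (a * p).
Proof.
move=> [b bG ->]; exists [seq (a * x.1, x.2) | x <- b].
  by move=> x /mapP [y yb ->] /=; exact: bG.
by rewrite big_map mulr_sumr; apply: eq_bigr => x _; rewrite mulrA.
Qed.

Lemma ideal_gen_gen (G : S -> Prop) p : G p -> ideal_gen G p.
Proof.
move=> Gp; exists [:: (1, p)]; last by rewrite big_seq1 mul1r.
by move=> x; rewrite inE => /eqP ->.
Qed.

Lemma ideal_gen_sum (G : S -> Prop) (I : Type) (r : seq I) (P : pred I) (F : I -> S) :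
  (forall i, P i -> ideal_gen G (F i)) -> ideal_gen G (\sum_(i <- r | P i) F i).
Proof.
by move=> GF; apply: big_ind => // [|p q]; [exact: ideal_gen0 | exact: ideal_genD].
Qed.

Lemma ideal_gen_min (G : S -> Prop) (J : S -> Prop) p :
  J 0 -> (forall p q, J p -> J q -> J (p + q)) ->
  (forall a q, G q -> J (a * q)) -> ideal_gen G p -> J p.
Proof.
move=> J0 JD JG [b bG ->]; elim: b bG => [|x b IHb] bG; first by rewrite big_nil.
rewrite big_cons; apply: JD; first by apply/JG/bG; exact: mem_head.
by apply: IHb => y yb; apply: bG; rewrite inE yb orbT.
Qed.

Lemma ideal_gen_iff (G G' : S -> Prop) p : (forall q, G q -> ideal_gen G' q) ->
  ideal_gen G p -> ideal_gen G' p.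
Proof.
move=> GG; apply: ideal_gen_min => [|q r|a q /GG].
- exact: ideal_gen0.
- exact: ideal_genD.
- exact: ideal_genM.
Qed.

(** Membership in a monomial ideal is tested on the support, term by term; all ideals of
    this file are compared through this criterion. *)
Lemma monomials_idealP (U : 'X_{1..n} -> Prop) (p : S) :
  monomials_ideal U p <-> forall v, p@_v != 0 -> exists2 u, U u & (u <= v)%MM.
Proof.
split.
  pose J (q : S) := forall v, q@_v != 0 -> exists2 u, U u & (u <= v)%MM.
  apply: (@ideal_gen_min _ J) => [v|q r hq hr v|a q [u Uu ->] v].
  - by rewrite mcoeff0 eqxx.
  - rewrite mcoeffD; have [q0|q0 _] := eqVneq q@_v 0; last exact: hq.
    by rewrite q0 add0r; exact: hr.
  - by rewrite mcoeffMXE; case: ifP => [uv _|]; [exists u | rewrite eqxx].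
move=> pU; rewrite [p]mpolyE big_seq; apply: ideal_gen_sum => v.
rewrite mcoeff_msupp => /pU [u Uu uv].
rewrite -(submK uv) mpolyXD -mul_mpolyC mulrA; apply: ideal_genM.
by apply: ideal_gen_gen; exists u.
Qed.

Lemma monomials_idealX (U : 'X_{1..n} -> Prop) v :
  monomials_ideal U ('X_[v] : S) <-> exists2 u, U u & (u <= v)%MM.
Proof.
split=> [/monomials_idealP /(_ v)|[u Uu uv]]; first by rewrite mcoeffX eqxx oner_eq0; apply.
apply/monomials_idealP => w; rewrite mcoeffX; case: (v =P w) => [<- _|]; last by rewrite eqxx.
by exists u.
Qed.

Lemma vars_idealP (p : S) :
  vars_ideal p <-> monomials_ideal (fun u => exists i, u = U_(i)%MM) p.
Proof.
split; apply: ideal_gen_iff => q.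
  by case=> i ->; apply: ideal_gen_gen; exists U_(i)%MM => //; exists i.
by case=> u [i ->] ->; apply: ideal_gen_gen; exists i.
Qed.

Lemma vars_ideal_X u : u != 0%MM -> vars_ideal ('X_[u] : S).
Proof.
move=> u0; apply/vars_idealP/monomials_idealX.
have [i ui|h] := pickP (fun i => u i != 0%N).
  by exists U_(i)%MM; [exists i | rewrite lep1mP].
by case/eqP: u0; apply/mnmP => i; rewrite mnm0E; have /negbFE/eqP := h i.
Qed.

Lemma ideal_exp_vars d (p : S) :
  ideal_exp (@vars_ideal n k) d p <-> monomials_ideal (fun u => mdeg u = d) p.
Proof.
split.
  apply: ideal_gen_iff => q [t tJ ->].
  suff h e (a : 'I_e -> S) : (forall i, vars_ideal (a i)) ->
     monomials_ideal (fun u => mdeg u = e) (\prod_(i < e) a i) by exact: h.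
  elim: e a => [|e IHe] a aJ.
    by rewrite big_ord0; apply/monomials_idealP => v _; exists 0%MM; rewrite ?mdeg0 //;
      apply/mnm_lepP => i; rewrite mnm0E.
  rewrite big_ord_recl mulrC.
  have := IHe (fun i => a (lift ord0 i)) (fun i => aJ _).
  move: (\prod_(i < e) _) => b bJ.
  pose J (q : S) := monomials_ideal (fun u : 'X_{1..n} => mdeg u = e.+1) (b * q).
  move: (aJ ord0); apply: (@ideal_gen_min _ J) => [|p1 q1 hp hq|c q1 [i ->]]; rewrite /J.
  - by rewrite mulr0; exact: ideal_gen0.
  - by rewrite mulrDr; exact: ideal_genD.
  rewrite mulrCA; apply: ideal_genM.
  pose J' (q : S) := monomials_ideal (fun u : 'X_{1..n} => mdeg u = e.+1) (q * 'X_i).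
  move: bJ; apply: (@ideal_gen_min _ J') => [|p2 q2 hp hq|f q2 [u ud ->]]; rewrite /J'.
  - by rewrite mul0r; exact: ideal_gen0.
  - by rewrite mulrDl; exact: ideal_genD.
  rewrite -mulrA -mpolyXD; apply/ideal_genM/ideal_gen_gen.
  by exists (u + U_(i))%MM; rewrite // mdegD mdeg1 ud addn1.
apply: ideal_gen_iff => q [u ud ->]; apply: ideal_gen_gen.
have [t _ tu] := sorted_factors ud.
exists [tuple 'X_(t i) | i < d]; first by move=> i; rewrite tnth_mktuple;
  apply: ideal_gen_gen; exists (t i).
rewrite -tu; under [RHS]eq_bigr do rewrite tnth_mktuple.
by rewrite (big_morph _ (@mpolyXD _ _) (@mpolyX0 _ _)).
Qed.

Lemma min_gen_deg d m : min_gen (ideal_exp (@vars_ideal n k) d) m -> mdeg m = d.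
Proof.
move=> [/ideal_exp_vars/monomials_idealX [u ud um] mmin].
rewrite -(mmin u) //; apply/ideal_exp_vars/monomials_idealX; exists u => //.
exact: lepm_refl.
Qed.

End Ideals.

(** * Multigraded chains *)

Section Resolution.
Variables (R : realFieldType) (k : fieldType) (n d : nat) (s : 'I_d -> 'I_n).
Hypothesis s_mono : forall p q : 'I_d, p <= q -> s p <= s q.
Hypothesis d_gt0 : 0 < d.
Local Open Scope ring_scope.

Local Notation S := {mpoly k[n]}.
Local Notation vset := {set 'X_{1..n < d.+1}}.
Implicit Types (A B : {set 'I_d * 'I_n}) (F G H : vset).

Variable X : vset -> Prop.
Hypothesis XP : forall F, X F <-> F = set0 \/ exists2 A, good_cell s A & F = cell A.

Lemma X_vertex (v : 'X_{1..n < d.+1}) : X [set v] <-> mdeg v = d.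
Proof.
split=> [/XP [/setP /(_ v)|[A gA e]]|vd].
- by rewrite !inE eqxx.
- have /cellP [c _ ->] : v \in cell A by rewrite -e inE.
  exact: mdeg_mon.
have [w [c [gc cv]]] := good_choice_exists s_mono d_gt0 vd.
apply/XP; right; exists (graph c); first by apply/existsP; exists w.
rewrite cell_graph; congr [set _]; apply/val_inj; exact/esym.
Qed.

Lemma vertices_ideal (p : S) : ideal_exp (@vars_ideal n k) d p <->
  monomials_ideal (fun u => exists2 v, X [set v] & u = val v) p.
Proof.
split=> [/ideal_exp_vars|h]; last apply/ideal_exp_vars; last move: h;
  move/monomials_idealP => h; apply/monomials_idealP => v /h [u hu uv]; exists u => //.
  have ub : (mdeg u < d.+1)%N by rewrite hu.
  by exists (BMultinom ub); rewrite //; apply/X_vertex.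
by case: hu => v' /X_vertex h' ->.
Qed.

Lemma chain_cell i (c : {ffun vset -> S}) : chain R X i c <->
  forall F, c F <> 0 -> exists A, [/\ good_cell s A, #|A| = (d + i)%N & F = cell A].
Proof.
split=> cX F /cX; last first.
  move=> [A [gA cA ->]]; split; first exact: X_cell gA.
    by apply/eqP/cell0; exact: good_cell_full gA.
  by rewrite (pdim_good_cell R s_mono gA) cA addKn.
move=> [/XP [->//|[A gA ->]] _]; rewrite (pdim_good_cell R s_mono gA) => cA.
exists A; split=> //; have := full_card (good_cell_full gA); lia.
Qed.

Section Incidence.
Variable eps : vset -> vset -> int.
Hypothesis eps_inc : incidence R X eps.
Local Notation bd := (@boundary k n d.+1 eps).
Local Notation aug := (@augmentation k n d.+1).

Lemma eps_label A G : good_cell s A -> eps (cell A) G != 0 ->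
  (label G <= label (cell A))%MM.
Proof.
move=> gA /(eps_good s_mono XP eps_inc gA) [B [_ BA _ ->]].
exact/labelS/cellS.
Qed.

(** The complex of free modules is multigraded, and its part of multidegree [mu] is the
    scalar complex of the cells whose label divides [mu]: [homogeneous_chain] and
    [strand] are the two directions of this identification. *)
Definition homogeneous_chain mu (f : vset -> k) : {ffun vset -> S} :=
  [ffun F => f F *: 'X_[(mu - label F)%MM]].

Definition strand (c : {ffun vset -> S}) mu (F : vset) : k :=
  if (label F <= mu)%MM then (c F)@_(mu - label F)%MM else 0.

Lemma bd_homogeneous mu i f : degree_below s mu i f ->
  bd (homogeneous_chain mu f) = homogeneous_chain mu (fun G => \sum_F (eps F G)%:~R * f F).
Proof.
move=> fdeg; apply/ffunP => G; rewrite !ffunE scaler_suml; apply: eq_bigr => F _.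
rewrite ffunE; have [->|/fdeg [A [/andP [gA le] _ ->]]] := eqVneq (f F) 0.
  by rewrite scale0r !mulr0 scale0r.
have [->|nz] := eqVneq (eps (cell A) G) 0; first by rewrite !mul0r scale0r.
rewrite -(label_cell (good_cell_full gA)) in le.
have lG := eps_label gA nz.
rewrite -mulrA -scalerAr -mpolyXD !mulrzl -scalerMzl; congr (_ *: 'X_[_] *~ _).
by apply/mnmP => a; move/mnm_lepP/(_ a): lG; move/mnm_lepP/(_ a): le; rewrite mnmDE !mnmBE; lia.
Qed.

(** Only the multidegrees below a bound contribute, so the decomposition of a chain into
    its strands is a sum over a finite type. *)
Lemma strand_sum N (c : {ffun vset -> S}) :
  (forall F, msize (c F) + mdeg (label F) <= N)%N ->
  c = \sum_(mu : 'X_{1..n < N}) homogeneous_chain mu (strand c mu).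
Proof.
move=> cN; apply/ffunP => F; rewrite sum_ffunE; apply/mpolyP => v.
rewrite raddf_sum /=; have [lt|ge] := ltnP (mdeg (v + label F)) N.
  rewrite (bigD1 (BMultinom lt)) //= ffunE mcoeffZ mcoeffX /strand lem_addl addmK eqxx mulr1.
  rewrite big1 ?addr0 // => mu ne; rewrite ffunE mcoeffZ mcoeffX; case: ifP => [le|];
    last by rewrite mul0r.
  case: eqP => [e|]; last by rewrite mulr0.
  by case/eqP: ne; apply/val_inj; rewrite /= -e submK.
rewrite memN_msupp_eq0; last first.
  apply/negP => /msize_mdeg_lt; have := cN F; move: ge; rewrite mdegD.
  by move: (msize _) (mdeg v) (mdeg _) => x y z; clear; lia.
rewrite big1 // => mu _; rewrite ffunE mcoeffZ mcoeffX /strand; case: ifP => [le|];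
  last by rewrite mul0r.
case: eqP => [e|]; last by rewrite mulr0.
by have := bmdeg mu; rewrite -(submK le) e ltnNge ge.
Qed.

Lemma strand_degree c mu i : chain R X i c -> degree_below s mu i (strand c mu).
Proof.
move=> /chain_cell cX F; rewrite /strand; case: ifP => [le nz|]; last by rewrite eqxx.
have /cX [A [gA cA FE]] : c F <> 0 by move=> c0; rewrite c0 mcoeff0 eqxx in nz.
by exists A; rewrite /below gA -(label_cell (good_cell_full gA)) -FE.
Qed.

Lemma strand_bd c mu i G : chain R X i c ->
  \sum_F (eps F G)%:~R * strand c mu F = strand (bd c) mu G.
Proof.
move=> /chain_cell cX; rewrite {2}/strand; case: ifP => lG; last first.
  apply: big1 => F _; rewrite /strand; case: ifP => lF; last by rewrite mulr0.
  have [->|/eqP /cX [A [gA _ FE]]] := eqVneq (c F) 0; first by rewrite mcoeff0 mulr0.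
  have [->|nz] := eqVneq (eps F G) 0; first by rewrite mul0r.
  by move: lG; rewrite (lepm_trans _ lF) // FE eps_label // -FE.
rewrite ffunE raddf_sum; apply: eq_bigr => F _ /=.
have [c0|/eqP /cX [A [gA _ FE]]] := eqVneq (c F) 0.
  by rewrite c0 mulr0 mcoeff0 /strand; case: ifP; rewrite ?c0 ?mcoeff0 mulr0.
have [->|nz] := eqVneq (eps F G) 0; first by rewrite !mul0r mcoeff0.
have lFG : (label G <= label F)%MM by rewrite FE eps_label // -FE.
rewrite -mulrA !mulrzl raddfMz /= mulrC mcoeffMXE /strand; congr (_ *~ _).
have -> : (label F - label G <= mu - label G)%MM = (label F <= mu)%MM.
  apply/mnm_lepP/mnm_lepP => h a; move: (h a) (mnm_lepP lG a) (mnm_lepP lFG a);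
    rewrite !mnmBE; lia.
case: ifP => // le; congr (_@__).
by apply/mnmP => a; move: (mnm_lepP le a) (mnm_lepP lG a) (mnm_lepP lFG a); rewrite !mnmBE; lia.
Qed.

Lemma strand_aug c mu : \sum_F strand c mu F = (aug c)@_mu.
Proof.
rewrite /augmentation raddf_sum; apply: eq_bigr => F _ /=.
by rewrite mulrC mcoeffMXE.
Qed.

Lemma bd_sum (I : finType) (f : I -> {ffun vset -> S}) : bd (\sum_i f i) = \sum_i bd (f i).
Proof.
apply/ffunP => G; rewrite sum_ffunE ffunE; under [RHS]eq_bigr do rewrite ffunE.
by rewrite exchange_big /=; apply: eq_bigr => F _; rewrite sum_ffunE mulr_sumr.
Qed.

Lemma chain_homogeneous mu i f : degree_below s mu i f -> chain R X i (homogeneous_chain mu f).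
Proof.
move=> fdeg; apply/chain_cell => F; rewrite ffunE => nz.
have /fdeg [A [/andP [gA _] cA ->]] : f F != 0 by apply/eqP => f0; case: nz; rewrite f0 scale0r.
by exists A.
Qed.

Lemma chain_sum (I : finType) i (f : I -> {ffun vset -> S}) :
  (forall j, chain R X i (f j)) -> chain R X i (\sum_j f j).
Proof.
move=> fX F nz; have [j fj|h] := pickP (fun j => f j F != 0); first by apply: (fX j); apply/eqP.
by case: nz; rewrite sum_ffunE big1 // => j _; have /negbFE/eqP := h j.
Qed.

(** Each strand of a cycle is a scalar cycle, so bounds by the matching; the bounding
    scalar chains are put together again. *)
Lemma exact_chain i c : chain R X i c ->
  (if i is 0 then aug c = 0 else bd c = 0) ->
  exists2 b, chain R X i.+1 b & bd b = c.
Proof.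
move=> cX cyc.
pose N := (\sum_F (msize (c F) + mdeg (label F)))%N.
have cN F : (msize (c F) + mdeg (label F) <= N)%N.
  by rewrite /N (bigD1 F) //= leq_addr.
have [f fP] : exists f : 'X_{1..n < N} -> vset -> k, forall mu : 'X_{1..n < N},
    degree_below s mu i.+1 (f mu) /\
    forall G, \sum_F (eps F G)%:~R * f mu F = strand c mu G.
  suff h (mu : 'X_{1..n < N}) : exists f : {ffun vset -> k}, degree_below s mu i.+1 f /\
    forall G, \sum_F (eps F G)%:~R * f F = strand c mu G.
    by have [f fP] := fin_all_exists h; exists f.
  have cyc' : scalar_cycle eps i (strand c mu).
    case: i cX cyc => [|i] cX cyc; first by rewrite /scalar_cycle strand_aug cyc mcoeff0.
    by move=> G; rewrite (strand_bd mu G cX) cyc /strand ffunE mcoeff0; case: ifP.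
  have [b bdeg bE] := scalar_acyclic s_mono d_gt0 XP eps_inc (strand_degree (mu := mu) cX) cyc'.
  exists (finfun b); split; last by move=> G; under eq_bigr do rewrite ffunE.
  by move=> F; rewrite ffunE; exact: bdeg.
exists (\sum_(mu : 'X_{1..n < N}) homogeneous_chain mu (f mu)).
  by apply: chain_sum => mu; apply: chain_homogeneous; case: (fP mu).
rewrite bd_sum [RHS](strand_sum cN); apply: eq_bigr => mu _.
have [fdeg fE] := fP mu; rewrite (bd_homogeneous fdeg); apply/ffunP => G.
by rewrite !ffunE fE.
Qed.

Lemma bd_bd i c : chain R X i.+1 c -> bd (bd c) = 0.
Proof.
move=> /chain_cell cX; apply/ffunP => H; rewrite !ffunE.
under eq_bigr => G _ do rewrite ffunE mulr_sumr.
rewrite exchange_big /=; apply: big1 => F _.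
have [->|/eqP /cX [A [gA _ FE]]] := eqVneq (c F) 0; first by apply: big1 => G _; rewrite !mulr0.
have XF : X F by rewrite FE; exact: X_cell gA.
have [_ _ _ /(_ F H XF) ee] := eps_inc.
transitivity ((\sum_G eps F G * eps G H)%:~R * ('X_[(label F - label H)%MM] * c F)); last first.
  by rewrite ee mul0r.
rewrite rmorph_sum /= mulr_suml; apply: eq_bigr => G _; rewrite rmorphM /=.
have [->|nz] := eqVneq (eps F G) 0; first by rewrite !(mul0r, mulr0).
have [->|nz'] := eqVneq (eps G H) 0; first by rewrite !(mul0r, mulr0).
rewrite FE in nz *; have lG := eps_label gA nz.
have [B [gB _ _ GE]] := eps_good s_mono XP eps_inc gA nz; rewrite GE in nz' lG *.
have lH := eps_label gB nz'.
have -> : (label (cell A) - label H)%MM =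
   ((label (cell A) - label (cell B)) + (label (cell B) - label H))%MM.
  by apply/mnmP => a; move: (mnm_lepP lG a) (mnm_lepP lH a); rewrite mnmDE !mnmBE; lia.
rewrite mpolyXD; ring.
Qed.

Lemma aug_bd c : chain R X 1 c -> aug (bd c) = 0.
Proof.
move=> /chain_cell cX; rewrite /augmentation.
under eq_bigr => G _ do rewrite ffunE mulr_sumr.
rewrite exchange_big /=; apply: big1 => F _.
have [->|/eqP /cX [A [gA cA FE]]] := eqVneq (c F) 0; first by apply: big1 => G _; rewrite !mulr0.
have XF : X F by rewrite FE; exact: X_cell gA.
have [_ _ /(_ F XF) edge _] := eps_inc.
transitivity ((\sum_G eps F G)%:~R * ('X_[label F] * c F)); last first.
  by rewrite edge ?mul0r // FE (pdim_good_cell R s_mono gA) cA addKn.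
rewrite rmorph_sum /= mulr_suml; apply: eq_bigr => G _.
have [->|nz] := eqVneq (eps F G) 0; first by rewrite !(mul0r, mulr0).
rewrite FE in nz *; have lG := eps_label gA nz.
rewrite -{2}(submK lG) mpolyXD; ring.
Qed.

Lemma aug_surjective (p : S) : ideal_exp (@vars_ideal n k) d p <->
  exists2 c, chain R X 0 c & aug c = p.
Proof.
split=> [/vertices_ideal|[c /chain_cell cX <-]]; last first.
  apply: ideal_gen_sum => F _; have [->|/eqP /cX [A [gA cA ->]]] := eqVneq (c F) 0.
    by rewrite mulr0; exact: ideal_gen0.
  rewrite mulrC; apply: ideal_genM.
  suff : ideal_exp (@vars_ideal n k) d 'X_[label (cell A)] by [].
  have [e eA] := full_select0 (good_cell_full gA).
  apply/ideal_exp_vars/monomials_idealX; exists (mon e); first exact: mdeg_mon.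
  by rewrite label_cell ?(good_cell_full gA) //; exact: mon_colsums.
pose J (q : S) := exists2 c, chain R X 0 c & aug c = q.
apply: (@ideal_gen_min _ _ _ J) => [|q r [c cX <-] [c' cX' <-]|a q [u [v Xv ->] ->]]; rewrite /J.
- exists 0 => [F|]; first by rewrite ffunE.
  by rewrite /augmentation big1 // => F _; rewrite ffunE mulr0.
- exists (c + c') => [F|]; last first.
    by rewrite /augmentation -big_split; apply: eq_bigr => F _; rewrite ffunE mulrDr.
  by rewrite ffunE; have [->|/eqP nz] := eqVneq (c F) 0; [rewrite add0r => /cX' | move=> _;
    exact: cX].
have vd : mdeg v = d by apply/X_vertex.
exists [ffun F => if F == [set v] then a else 0] => [F|].
  rewrite ffunE; case: eqP => // -> _; split=> //.
    by apply/eqP/set0Pn; exists v; rewrite inE.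
  by rewrite /pdim !big_set1 subrr genmx0 mxrank0.
rewrite /augmentation (bigD1 [set v]) //= ffunE eqxx big1 ?addr0 => [|F /negPf nF].
  by rewrite mulrC; congr (_ * 'X_[_]); apply/mnmP => b; rewrite labelE big_set1.
by rewrite ffunE nF mulr0.
Qed.

Lemma free_resolution_boxes : free_resolution R X eps (ideal_exp (@vars_ideal n k) d).
Proof.
split; first exact: aug_surjective.
  move=> c cX; split=> [c0|[b bX <-]]; first exact: exact_chain cX c0.
  exact: aug_bd.
move=> i c cX; split=> [c0|[b bX <-]]; first exact: (exact_chain cX c0).
exact: bd_bd bX.
Qed.

Lemma minimal_boxes : minimal_complex R k X eps.
Proof.
move=> i c /chain_cell cX G; rewrite ffunE; apply: ideal_gen_sum => F _.
have [->|/eqP /cX [A [gA _ FE]]] := eqVneq (c F) 0; first by rewrite mulr0; exact: ideal_gen0.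
have [->|nz] := eqVneq (eps F G) 0; first by rewrite !mul0r; exact: ideal_gen0.
rewrite mulrC mulrA; apply: ideal_genM; apply: vars_ideal_X.
rewrite FE in nz *; have [x [xA fx GE]] := eps_facet s_mono XP eps_inc gA nz.
have lG := eps_label gA nz.
apply: contra (label_remove xA fx) => /eqP e; rewrite -GE; apply/eqP.
by rewrite -(submK lG) e add0m.
Qed.

End Incidence.

(** Any complex with these faces supports a minimal resolution; the description of the
    faces is the only thing that has to be known about it. *)
Lemma boxes_support : supports_minimal_free_resolution R X (ideal_exp (@vars_ideal n k) d).
Proof.
split; first exact: (complex_polytopal R s_mono XP).
- exact: vertices_ideal.
- exact: (incidence_exists R s_mono d_gt0 XP).
by move=> eps eps_inc; split; [exact: free_resolution_boxes | exact: minimal_boxes].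
Qed.

End Resolution.

(** * Borel ideals and boxes as labelled cells *)

Section Boxes.
Variables (n d : nat) (s : 'I_d -> 'I_n).
Hypothesis s_mono : forall p q : 'I_d, p <= q -> s p <= s q.
Variable u : 'I_n.

Local Notation choice := {ffun 'I_d -> 'I_n}.
Implicit Types (A B : {set 'I_d * 'I_n}) (c e : choice).

Lemma Qrank_vrank (a : 'I_n) : Qrank (ordS u) a = vrank u a - u.+1.
Proof.
rewrite /Qrank /vrank /=; have an := ltn_ord a; have un := ltn_ord u.
have [lt|ge] := ltnP u.+1 n.
  rewrite (modn_small lt); case: (leqP a u) => au.
    by rewrite modn_small; lia.
  have -> : a + (n - u.+1) = (a - u.+1) + n by lia.
  by rewrite modnDr modn_small; lia.
have e : u.+1 = n by lia.
by rewrite e modnn subn0 modnDr modn_small // ifT; lia.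
Qed.

Lemma Qlt_vrank a b : Qlt (ordS u) a b = (vrank u a < vrank u b).
Proof.
rewrite /Qlt !Qrank_vrank; move: (vrank_gt u a) (vrank_gt u b).
by move: (vrank u a) (vrank u b) => x y; lia.
Qed.

Lemma Qle_vrank a b : Qle (ordS u) a b = (vrank u a <= vrank u b).
Proof.
rewrite /Qle !Qrank_vrank; move: (vrank_gt u a) (vrank_gt u b).
by move: (vrank u a) (vrank u b) => x y; lia.
Qed.

Lemma vrank_ordS a : vrank u (ordS u) <= vrank u a.
Proof.
suff -> : vrank u (ordS u) = u.+1 by case/andP: (vrank_gt u a).
rewrite /vrank /=; have un := ltn_ord u; have [lt|ge] := ltnP u.+1 n.
  by rewrite modn_small // ifF //; lia.
have e : u.+1 = n by lia.
have -> : u.+1 %% n = 0 by rewrite e modnn.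
by rewrite leq0n add0n.
Qed.

Lemma in_cyc_interval (a b x : 'I_n) : vrank u a <= vrank u b ->
  (x \in cyc_interval a b) = (vrank u a <= vrank u x <= vrank u b).
Proof.
rewrite inE /vrank; move: (ltn_ord a) (ltn_ord b) (ltn_ord x) (ltn_ord u).
by do !case: ifP; lia.
Qed.

(** ** The monomials of the principal Borel ideal *)

(** The minimal generators of the principal Borel ideal. A choice need not be separated
    here, which makes the stability under Borel moves immediate. *)
Definition under_window (f : 'X_{1..n}) : Prop :=
  exists2 c : choice, forall p, (p, c p) \in window s u & mon c = f.

Lemma mon_replace c p a (c' := [ffun q => if q == p then a else c q] : choice) :
  mon c' = (mon c - U_(c p) + U_(a))%MM.
Proof.
apply/mnmP => b; rewrite mnmDE mnmBE /mon !mnm_sumE (bigD1 p) //=.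
rewrite [in RHS](bigD1 p) //= ffunE eqxx !mnm1E.
rewrite (eq_bigr (fun q => U_(c q)%MM b)); last by move=> q /negPf qp; rewrite ffunE qp.
by rewrite addKn addnC.
Qed.

Lemma factor_window p : (p, s p) \in window s u.
Proof. by rewrite window_vrank. Qed.

Section Borel.
Variable k : fieldType.
Local Notation m := (mon [ffun p => s p]).

Lemma under_window_Qborel : Qborel (ordS u) (monomials_ideal (k := k) under_window).
Proof.
split; first by exists under_window.
move=> f a b /monomials_idealX [g [c cw <-] gf] fb; rewrite Qlt_vrank => ab.
apply/monomials_idealX.
have [p /eqP cp|nb] := pickP (fun p => c p == b).
  exists (mon [ffun q => if q == p then a else c q]).
    exists [ffun q => if q == p then a else c q] => // q; rewrite ffunE.
    case: eqP => [->|_]; last exact: cw.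
    have := cw p; rewrite !window_vrank /= cp; exact/leq_trans/ltnW.
  rewrite mon_replace cp; apply/mnm_lepP => x.
  have := mnm_lepP gf x; rewrite !mnmDE !mnmBE.
  by move: (mon c x) (f x) (U_(b)%MM x) (U_(a)%MM x); lia.
exists (mon c); first by exists c.
apply/mnm_lepP => x; have := mnm_lepP gf x; rewrite mnmDE mnmBE mnm1E.
case: (b =P x) => [<- _|_]; last by rewrite subn0 => h; apply: leq_trans (leq_addr _ _).
by rewrite monE (_ : [set p | c p == b] = set0) ?cards0 //; apply/setP => p; rewrite !inE nb.
Qed.

(** The factors are replaced one after the other; each replacement is a Borel move. *)
Lemma principal_under f : under_window f -> principal_Qborel (k := k) (ordS u) m 'X_[f].
Proof.
move=> [c cw <-] B [_ Bmove] Bm.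
suff h j : j <= d -> B 'X_[mon [ffun p : 'I_d => if p < j then c p else s p]].
  have -> : c = [ffun p : 'I_d => if p < d then c p else s p].
    by apply/ffunP => p; rewrite ffunE ltn_ord.
  exact: h.
elim: j => [_|j IHj jd].
  by rewrite (_ : [ffun _ => _] = [ffun p => s p]) //; apply/ffunP => p; rewrite !ffunE.
have := IHj (ltnW jd); set e := [ffun _ => _] => Be.
pose p := Ordinal jd.
have -> : [ffun q : 'I_d => if q < j.+1 then c q else s q] =
          [ffun q => if q == p then c p else e q].
  apply/ffunP => q; rewrite !ffunE -val_eqE /= ltnS leq_eqVlt.
  by case: eqP => //= qj; congr (c _); apply/val_inj.
rewrite mon_replace.
have ep : e p = s p by rewrite ffunE ltnn.
have [->|cs] := eqVneq (c p) (s p).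
  suff -> : (mon e - U_(e p) + U_(s p))%MM = mon e by [].
  rewrite -mon_replace; congr mon; apply/ffunP => q; rewrite ffunE.
  by case: eqP => // ->.
apply: Bmove => //.
  by rewrite monE; apply/card_gt0P; exists p; rewrite inE.
rewrite Qlt_vrank ep ltn_neqAle; have := cw p; rewrite window_vrank => ->.
by rewrite andbT; apply: contra cs => /eqP/vrank_inj ->.
Qed.

Lemma min_gen_principal f :
  min_gen (principal_Qborel (k := k) (ordS u) m) f <-> under_window f.
Proof.
have sub v : principal_Qborel (k := k) (ordS u) m 'X_[v] ->
    exists2 g, under_window g & (g <= v)%MM.
  move=> h; apply/monomials_idealX; apply: h; first exact: under_window_Qborel.
  apply/monomials_idealX; exists m; last exact: lepm_refl.
  by exists [ffun p => s p] => // p; rewrite ffunE factor_window.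
split=> [[/sub [g gw gf] fmin]|fw].
  by rewrite -(fmin g) //; exact: principal_under.
split; first exact: principal_under.
move=> v /sub [g [c _ gc] gv] vf; have [e _ ef] := fw.
have deg_f : mdeg f = d by rewrite -ef mdeg_mon.
have deg_g : mdeg g = d by rewrite -gc mdeg_mon.
have := congr1 mdeg (submK vf); rewrite mdegD deg_f => h.
have := congr1 mdeg (submK gv); rewrite mdegD deg_g => h'.
have /eqP : mdeg (f - v) = 0.
  by move: h h'; move: (mdeg v) (mdeg (f - v)) (mdeg (v - g)); clear; lia.
by rewrite mdeg_eq0 => /eqP fv0; rewrite -(submK vf) fv0 add0m.
Qed.

End Borel.

Hypothesis d_gt0 : 0 < d.

(** Sorting a choice is awkward cyclically. Instead take the separated choice that exists
    in some window; by the comparison of masses it also lies in the window of [u]. *)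
Lemma under_window_good f : under_window f -> exists2 c : choice, good s u (graph c) & mon c = f.
Proof.
move=> [e ew ef]; have fd : mdeg f = d by rewrite -ef mdeg_mon.
have [w [c [gc cf]]] := good_choice_exists s_mono d_gt0 fd.
exists c => //; apply: (good_window gc).
have wc : graph c \subset window s (s w) by case/and3P: gc.
have cw q : (q, c q) \in window s (s w) by apply: (subsetP wc); rewrite in_graph.
have := mass_window (indicator_ge0 c) (indicator_ge0 e) (indicator_row c)
  (indicator_row e) (indicator_supp cw) (indicator_supp ew).
move=> h; apply/subsetP => -[p a]; rewrite in_graph => /eqP cp; apply: h => [b|].
  by rewrite !indicator_col cf ef.
by rewrite /indicator cp eqxx oner_eq0.
Qed.

(** ** The box of a good choice *)

(** In component p, the interval from the previous factor to the factor [c p]. As the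
    factors increase, being after the previous one is the same as being after all
    earlier ones, which avoids any successor on factors. *)
Definition box_cell c : {set 'I_d * 'I_n} :=
  [set x | (vrank u x.2 <= vrank u (c x.1)) &&
    [forall q, (frank s u q < frank s u x.1) ==> (vrank u (c q) <= vrank u x.2)]].

Lemma good_choice_mono c p q : good s u (graph c) -> frank s u p < frank s u q ->
  vrank u (c p) <= vrank u (c q).
Proof.
move=> /(goodP s_mono) [_ _ sc] pq.
by apply: (sc (p, c p) (q, c q)); rewrite ?in_graph.
Qed.

Lemma box_cell_good c : good s u (graph c) -> good s u (box_cell c).
Proof.
move=> gc; apply/(goodP s_mono); split.
- move=> p; exists (c p); rewrite inE leqnn /=; apply/forallP => q.
  by apply/implyP; exact: good_choice_mono.
- apply/subsetP => -[p a]; rewrite inE window_vrank /= => /andP [h _].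
  apply: leq_trans h _; rewrite -(window_vrank s u (p, c p)).
  by case/and3P: gc => _ _ /subsetP; apply; rewrite in_graph.
move=> [p a] [q b]; rewrite !inE /= => /andP [ha _] /andP [_ /forallP /(_ p)].
by move=> /implyP h /h; exact: leq_trans.
Qed.

Definition frank_order : seq 'I_d :=
  sort (fun p q => frank s u p <= frank s u q) (enum 'I_d).

Lemma Qfactors_mon c : good s u (graph c) ->
  Qfactors (ordS u) (mon c) = [seq c p | p <- frank_order].
Proof.
move=> gc.
have tot : total (Qle (ordS u)) by move=> a b; exact: leq_total.
have tr : transitive (Qle (ordS u)) by move=> a b e; exact: leq_trans.
have as_ : antisymmetric (Qle (ordS u)).
  by move=> a b; rewrite !Qle_vrank -eqn_leq => /eqP/vrank_inj.
apply: (sorted_eq tr as_); first exact: sort_sorted.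
  rewrite sorted_map; apply: (sub_sorted (e := fun p q => frank s u p <= frank s u q)).
    move=> p q; rewrite leq_eqVlt /relpre /= Qle_vrank => /orP [/eqP/frank_inj ->//|].
    exact: good_choice_mono.
  by apply: sort_sorted => p q; exact: leq_total.
rewrite perm_sort -/(factors (mon c)).
have -> : mon c = (\sum_(b <- [seq c p | p <- enum 'I_d]) U_(b))%MM.
  by rewrite big_map big_enum.
apply: perm_trans (perm_factors _) _; apply: perm_map.
by rewrite perm_sym perm_sort.
Qed.

Lemma box_good c : good s u (graph c) -> box d (ordS u) (mon c) = cell (box_cell c).
Proof.
move=> gc; pose l := frank_order.
have sl : size l = d by rewrite size_sort size_enum_ord.
have pl : perm_eq l (enum 'I_d) by rewrite perm_sort.
have ul : uniq l by rewrite (perm_uniq pl) enum_uniq.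
have in_l p : p \in l by rewrite (perm_mem pl) mem_enum.
pose p0 : 'I_d := Ordinal d_gt0.
have lt_l : forall i j, i < d -> j < d -> (frank s u (nth p0 l i) < frank s u (nth p0 l j))
  = (i < j).
  have tr : transitive (fun p q => frank s u p <= frank s u q) by move=> x y z; exact: leq_trans.
  have sorted_l : sorted (fun p q => frank s u p <= frank s u q) l.
    by apply: sort_sorted => p q; exact: leq_total.
  have le_l i j : i < d -> j < d -> i <= j -> frank s u (nth p0 l i) <= frank s u (nth p0 l j).
    move=> id jd ij.
    have inl r : r < d -> r \in [pred x | x < size l] by rewrite inE sl.
    apply: (sorted_leq_nth tr _ p0 sorted_l _ _ (inl i id) (inl j jd) ij).
    by move=> x; exact: leqnn.
  move=> i j id jd; apply/idP/idP => [|ij].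
    by apply: contraTT; rewrite -!leqNgt; exact: le_l.
  rewrite ltn_neqAle le_l ?(ltnW ij) // andbT.
  apply/negP => /eqP/frank_inj/eqP; rewrite nth_uniq ?sl // => /eqP e.
  by rewrite e ltnn in ij.
have x0 : 'I_n := c p0.
have nth_l p : exists2 j, j < d & p = nth p0 l j.
  exists (index p l); last by rewrite nth_index.
  by apply: leq_trans (_ : size l <= d); rewrite ?index_mem // sl.
have memE e : all2 (fun (a : 'I_n) (J : {set 'I_n}) => a \in J) [seq e p | p <- l]
      (box_intervals (ordS u) (mon c)) = selects e (box_cell c).
  rewrite /box_intervals (Qfactors_mon gc) -/l all2E size_pairmap !size_map eqxx /=.
  set jv := pairmap _ _ _.
  have szj : size jv = d by rewrite size_pairmap size_map.
  have szz : size (zip [seq e p | p <- l] jv) = d by rewrite size_zip szj size_map sl minnn.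
  have pos j : j < d -> (nth (x0, set0) (zip [seq e p | p <- l] jv) j).1 \in
       (nth (x0, set0) (zip [seq e p | p <- l] jv) j).2 =
       ((nth p0 l j, e (nth p0 l j)) \in box_cell c).
    move=> jd; rewrite nth_zip ?szj ?size_map //= (nth_map p0) ?sl //.
    rewrite (nth_pairmap x0) ?size_map ?sl // (nth_map p0) ?sl //.
    set p := nth p0 l j; rewrite [RHS]inE /=.
    case: j jd @p => [|j] jd p /=.
      rewrite in_cyc_interval ?vrank_ordS //=; apply/esym/andb_idr => _.
      apply/forallP => q; apply/implyP; have [i id ->] := nth_l q.
      by rewrite lt_l.
    rewrite (nth_map p0) ?sl ?(ltnW jd) // in_cyc_interval; last first.
      by apply: good_choice_mono gc _; rewrite lt_l // ltnW.
    rewrite andbC; congr (_ && _); apply/idP/forallP => [h q|/(_ (nth p0 l j))].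
      apply/implyP; have [i id ->] := nth_l q;
        rewrite lt_l // ltnS leq_eqVlt => /orP [/eqP -> //|ij].
      by apply: leq_trans h; apply: good_choice_mono gc _; rewrite lt_l // ltnW.
    by rewrite lt_l // ?(ltnW jd) // ltnSn.
  apply/(all_nthP (x0, set0))/selectsP => h.
    by move=> p; have [j jd ->] := nth_l p; rewrite -pos //; apply: h; rewrite szz.
  by move=> j; rewrite szz => jd; rewrite /= pos.
have sum_l (e : choice) : (\sum_(a <- [seq e p | p <- l]) U_(a))%MM = mon e.
  by rewrite big_map (perm_big _ pl) big_enum.
apply/setP => v; rewrite inE; apply/existsP/cellP.
  move=> [t /andP [tb /eqP tv]].
  pose e : choice := [ffun p => nth x0 t (index p l)].
  have te : t = [seq e p | p <- l] :> seq _.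
    apply: (@eq_from_nth _ x0); first by rewrite size_tuple size_map sl.
    move=> j; rewrite size_tuple => jd; rewrite (nth_map p0) ?sl // ffunE.
    by rewrite index_uniq ?sl.
  exists e; first by rewrite -memE -te.
  by apply/val_inj; rewrite /= -tv te sum_l.
move=> [e ecell ->]; have st : size [seq e p | p <- l] == d by rewrite size_map sl.
by exists (Tuple st); rewrite /= memE ecell sum_l eqxx.
Qed.

End Boxes.

(** ** The union of the complexes of boxes *)

(** A face of a box restricts the intervals of the box, which are weakly increasing and in
    the window. Conversely a good cell is a face of the box of its largest vertex. *)
Lemma complex_good_cells (R : realFieldType) (k : fieldType) (n d : nat)
    (s : 'I_d -> 'I_n) (s_mono : forall p q : 'I_d, p <= q -> s p <= s q)
    (d_gt0 : 0 < d) (m : 'X_{1..n}) (ms : (\sum_p U_(s p))%MM = m)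
    (F : {set 'X_{1..n < d.+1}}) :
  (exists2 u : 'I_n, m u != 0%N &
     complex_of_boxes R (ordS u) (principal_Qborel (k := k) (ordS u) m) F) <->
  F = set0 \/ exists2 A, good_cell s A & F = cell A.
Proof.
have mE : m = mon [ffun p => s p].
  by rewrite -ms /mon; apply: eq_bigr => p _; rewrite ffunE.
have supp u : m u != 0 -> exists w, s w = u.
  rewrite mE monE -lt0n => /card_gt0P [w]; rewrite inE ffunE => /eqP <-.
  by exists w.
have in_supp w : m (s w) != 0.
  by rewrite mE monE -lt0n; apply/card_gt0P; exists w; rewrite inE ffunE.
split.
  move=> [u /supp [w <-] [f]]; rewrite mE => /min_gen_principal.
  move=> /(under_window_good s_mono d_gt0) [c gc <-].
  rewrite (box_good s_mono d_gt0 gc) => /face_cell_inv [->|[B [fB BJ ->]]]; first by left.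
  right; exists B => //; apply/existsP; exists w.
  exact: good_sub (box_cell_good s_mono gc) BJ fB.
have gen w c : good s (s w) (graph c) ->
    min_gen (principal_Qborel (k := k) (ordS (s w)) m) (mon c).
  move=> /and3P [_ _ /subsetP wc]; rewrite mE; apply/min_gen_principal.
  by exists c => // p; apply: wc; rewrite in_graph.
move=> [->|[A /existsP [w gA] ->]].
  pose w := Ordinal d_gt0; exists (s w) => //.
  exists m; last exact: set0_face.
  rewrite {2}mE mE; apply/min_gen_principal.
  by exists [ffun p => s p] => // p; rewrite ffunE factor_window.
have [fA _ sA] := goodP s_mono _ _ gA.
have [lh lhP] := extremes (s w) (introT (fullP A) fA).
pose c := [ffun p => (lh p).2].
have cA : selects c A by apply/selectsP => p; rewrite ffunE; case: (lhP p).
have gc : good s (s w) (graph c).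
  by apply: good_sub gA _ (graph_full _) => //; rewrite -selects_graph.
exists (s w) => //; exists (mon c); first exact: gen.
rewrite (box_good s_mono d_gt0 gc).
apply: (face_cell R s_mono (box_cell_good s_mono gc)); first exact/fullP.
apply/subsetP => -[p a] pa; rewrite inE /= ffunE; have [_ hA le] := lhP p.
have /andP [_ ->] := le a pa; apply/forallP => q; apply/implyP => qp.
by have := sA (q, c q) (p, a) (selectsP _ _ cA q) pa qp.
Qed.

(* [ordS u] is u + 1 modulo n. *)
Theorem theorem5p12 (R : realFieldType) (k : fieldType) (n d : nat)
    (d_ge1 : (1 <= d)%N) (m : 'X_{1..n})
    (m_gen : min_gen (ideal_exp (@vars_ideal n k) d) m) :
  supports_minimal_free_resolution R
    (fun F : {set 'X_{1..n < d.+1}} =>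
       exists2 u : 'I_n, m u != 0%N &
         complex_of_boxes R (ordS u)
           (principal_Qborel (k := k) (ordS u) m) F)
    (ideal_exp (@vars_ideal n k) d).
Proof.
have [s s_mono ms] := sorted_factors (min_gen_deg m_gen).
apply: (boxes_support _ _ s_mono d_ge1) => F.
exact: complex_good_cells.
Qed.
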